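(* Let $G$ be a compactly generated locally compact metabelian group. Then (1) the union $\mathrm{W}(G)$ of all compact normal subgroups of $G$ is a compact normal subgroup (so $G$ has a maximal compact normal subgroup), and $\mathrm{W}(G/\mathrm{W}(G))$ is trivial; (2) if $\mathrm{W}(G)$ is trivial and $G$ is totally disconnected, then the derived subgroup $[G,G]$ is closed.
   Context: A locally compact group is metabelian if its derived subgroup $[G,G]$ is abelian. Compactly generated means generated as an abstract group by a compact subset. *)

(* Defs.v *)
From HB Require Import structures.
From mathcomp Require Import all_boot all_order all_algebra.
From mathcomp Require Import all_classical all_reals all_analysis.
Set Implicit Arguments. Unset Strict Implicit. Unset Printing Implicit Defensive.
Local Open Scope classical_set_scope.

Record topGroup (T : topologicalType) := TopGroup {
  tg_mul : T -> T -> T;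
  tg_inv : T -> T;
  tg_one : T;
  tg_mulA : forall x y z, tg_mul x (tg_mul y z) = tg_mul (tg_mul x y) z;
  tg_mul1g : forall x, tg_mul tg_one x = x;
  tg_mulg1 : forall x, tg_mul x tg_one = x;
  tg_mulVg : forall x, tg_mul (tg_inv x) x = tg_one;
  tg_mulgV : forall x, tg_mul x (tg_inv x) = tg_one;
  tg_mul_cont : continuous (fun p : T * T => tg_mul p.1 p.2);
  tg_inv_cont : continuous tg_inv
}.

Section TopGroupDefs.
Context {T : topologicalType} (G : topGroup T).
Local Notation "x * y" := (tg_mul G x y).
Local Notation "x ^-1" := (tg_inv G x).
Local Notation "1" := (tg_one G).

Definition is_subgroup (H : set T) : Prop :=
  H 1 /\ (forall x y, H x -> H y -> H (x * y)) /\ (forall x, H x -> H (x^-1)).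

Definition is_normal_subgroup (H : set T) : Prop :=
  is_subgroup H /\ (forall g h, H h -> H ((g * h) * g^-1)).

Definition gen_subgroup (A : set T) : set T :=
  [set x | forall H, is_subgroup H -> A `<=` H -> H x].

Definition commg (x y : T) : T := ((x^-1 * y^-1) * x) * y.

Definition derived : set T :=
  gen_subgroup [set z | exists x y, z = commg x y].

Definition metabelian : Prop :=
  forall x y, derived x -> derived y -> x * y = y * x.

Definition compactly_generated : Prop :=
  exists K : set T, compact K /\ gen_subgroup K = [set: T].

Definition W : set T :=
  [set x | exists N : set T, [/\ compact N, is_normal_subgroup N & N x]].

End TopGroupDefs.

(* locally compact groups are taken Hausdorff (standard convention) *)
Definition locally_compact_group {T : topologicalType} (G : topGroup T) : Prop :=
  hausdorff_space T /\ locally_compact [set: T].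

(* pi : G -> H is a quotient map of topological groups with kernel N:
   a continuous open surjective group homomorphism whose kernel is N.
   (This characterizes G/N up to isomorphism of topological groups.) *)
Definition is_quotient_map {T U : topologicalType} (G : topGroup T)
  (H : topGroup U) (N : set T) (pi : T -> U) : Prop :=
  [/\ forall x y, pi (tg_mul G x y) = tg_mul H (pi x) (pi y),
      continuous pi,
      (forall A : set T, open A -> open (pi @` A)),
      (forall u : U, exists x, pi x = u) &
      (forall x, pi x = tg_one H <-> N x)].

(* Main.v *)
Require Import Defs.
From HB Require Import structures.
From mathcomp Require Import all_boot all_order all_algebra.
From mathcomp Require Import all_classical all_reals all_analysis.
From mathcomp Require Import zify.

Set Implicit Arguments. Unset Strict Implicit. Unset Printing Implicit Defensive.
Import Order.TTheory GRing.Theory Num.Theory.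
Local Open Scope classical_set_scope.
Local Open Scope ring_scope.

(** Let [D] be the derived subgroup. Since [G] is compactly generated, a compact
    neighbourhood of the identity in the closure of [W] can be enlarged to a
    compact normal subgroup, so [W] is closed and every compact subset of [W]
    lies in one compact normal subgroup. The closure [A] of [D] is abelian and
    of the form [Z[g_1, ..., g_m] F + V] with [F] finite, [V] a compact
    neighbourhood and commuting conjugations [g_i]. Hilbert's basis argument,
    carried out one [g_i] at a time modulo [V], shows that the directed family of
    compact normal subgroups inside [A] has a largest member, as soon as this
    holds inside each group [<F'> + V], [F'] finite; there it follows from the
    fact that the bounded subgroups of a compactly generated abelian group are
    uniformly bounded (Weil's recurrence lemma and a doubling argument). Hence
    [W :&: A] is compact, and a second application to the closure of [W D], which
    is abelian modulo [W :&: A], shows that [W] is compact.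

    If [W] is trivial and [G] is totally disconnected, take a compact open
    subgroup [L 0] of [A] and let [L n.+1] be the largest part of [L n] mapped
    into [L n] by the conjugations [g_i^(+-1)]; the [L n] intersect trivially.
    Comparing leading coefficients for the lexicographic order, Dickson's lemma
    gives [L n = L n.+1 + \sum_i (g_i - 1) L n.+1] for all large [n], so [L n] is
    contained in the compact set [\sum_i (g_i - 1) L n.+1] of elements of [D], and
    [D] is open in [A]. *)

(** * Reflexive decision of identities in abelian groups *)

Section AbelianGroupTactic.
Variable M : zmodType.

Inductive zexp := ZVar of nat | ZZero | ZAdd of zexp & zexp | ZOpp of zexp.

Fixpoint zeval (env : seq M) (e : zexp) : M :=
  match e with
  | ZVar n => nth 0 env n
  | ZZero => 0
  | ZAdd e1 e2 => zeval env e1 + zeval env e2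
  | ZOpp e1 => - zeval env e1
  end.

Fixpoint zcoef (e : zexp) (i : nat) : int :=
  match e with
  | ZVar n => (i == n)%:Z
  | ZZero => 0
  | ZAdd e1 e2 => zcoef e1 i + zcoef e2 i
  | ZOpp e1 => - zcoef e1 i
  end.

Lemma zevalE env e :
  zeval env e = \sum_(i < size env) nth 0 env i *~ zcoef e i.
Proof.
elim: e => [n||e1 IH1 e2 IH2|e1 IH1] /=.
- case: (ltnP n (size env)) => nlt.
    rewrite (bigD1 (Ordinal nlt)) //= eqxx mulr1z big1 ?addr0 // => i /negbTE ni.
    by rewrite -val_eqE /= in ni; rewrite ni mulr0z.
  rewrite nth_default // big1 // => i _.
  by have := ltn_ord i; case: eqP => [->|_ _]; [rewrite ltnNge nlt|rewrite mulr0z].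
- by rewrite big1 // => i _; rewrite mulr0z.
- by rewrite IH1 IH2 -big_split /=; apply: eq_bigr => i _; rewrite mulrzDr.
- by rewrite IH1 -sumrN; apply: eq_bigr => i _; rewrite mulrNz.
Qed.

(** Indices from [size env] on can be ignored because [nth] returns 0 there. In [abel] the
    hypothesis is closed by computation in [int]. *)
Lemma zeval_eq env e1 e2 :
  all (fun i => zcoef e1 i == zcoef e2 i) (iota 0 (size env)) ->
  zeval env e1 = zeval env e2.
Proof.
move=> /allP h; rewrite !zevalE; apply: eq_bigr => i _.
by rewrite (eqP (h i _)) // mem_iota /= add0n ltn_ord.
Qed.
End AbelianGroupTactic.

(* Atoms are compared up to conversion: the same term may occur with different
   paths to its algebraic structure. *)
Ltac zmem x l :=
  lazymatch l with
  | nil => constr:(false)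
  | ?y :: ?l' =>
      match constr:(true) with
      | _ => let _ := match goal with _ => unify x y end in constr:(true)
      | _ => zmem x l'
      end
  end.
Ltac zindex x l :=
  lazymatch l with
  | ?y :: ?l' =>
      match constr:(true) with
      | _ => let _ := match goal with _ => unify x y end in constr:(O)
      | _ => let n := zindex x l' in constr:(S n)
      end
  end.
Ltac zatoms t l :=
  lazymatch t with
  | GRing.add ?a ?b => let l1 := zatoms a l in zatoms b l1
  | GRing.opp ?a => zatoms a l
  | GRing.zero => l
  | _ => lazymatch zmem t l with true => l | false => constr:(t :: l) end
  end.
Ltac zreify t l :=
  lazymatch t with
  | GRing.add ?a ?b =>
      let x := zreify a l in let y := zreify b l in constr:(ZAdd x y)
  | GRing.opp ?a => let x := zreify a l in constr:(ZOpp x)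
  | GRing.zero => constr:(ZZero)
  | _ => let n := zindex t l in constr:(ZVar n)
  end.
(* Decides equalities of integral combinations in an arbitrary [zmodType]. *)
Ltac abel :=
  lazymatch goal with
  | |- @eq ?T ?a ?b =>
      let l1 := zatoms a (@nil T) in
      let l := zatoms b l1 in
      let x := zreify a l in
      let y := zreify b l in
      exact: (@zeval_eq _ l x y isT)
  end.


(** * Subgroups, sums of subsets and integral spans in an abelian group *)

Section Subgroups.
Variable M : zmodType.
Implicit Types (A B D H V : set M) (F : seq M).

Definition subgrp H := H 0 /\ forall x y, H x -> H y -> H (x - y).

Definition sumset A B : set M := [set z | exists2 x, A x & B (z - x)].

(** Recursion on the list peels off one generator at a time, the shape of the later inductions on
    generators. *)
Fixpoint zspan F : set M :=
  if F is f :: F' then [set x | exists n : int, zspan F' (x - f *~ n)]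
  else [set 0].

Lemma subgrpN H x : subgrp H -> H x -> H (- x).
Proof. by move=> [h0 hB] hx; rewrite -sub0r; exact: hB. Qed.

Lemma subgrpD H x y : subgrp H -> H x -> H y -> H (x + y).
Proof. by move=> gH hx hy; rewrite -[y]opprK; apply: gH.2 => //; exact: subgrpN. Qed.

Lemma subgrpMz H x n : subgrp H -> H x -> H (x *~ n).
Proof.
move=> gH hx; have hn k : H (x *+ k).
  by elim: k => [|k IH]; [exact: gH.1|rewrite mulrS; exact: subgrpD].
case: n => n; first by rewrite -pmulrn.
by rewrite NegzE mulrNz -pmulrn; apply: subgrpN.
Qed.

Lemma subgrpI H H' : subgrp H -> subgrp H' -> subgrp (H `&` H').
Proof.
move=> [h0 hB] [h0' hB']; split=> // x y [? ?] [? ?].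
by split; [exact: hB|exact: hB'].
Qed.

Lemma subgrp_zspan F : subgrp (zspan F).
Proof.
elim: F => [|f F IH]; first by split=> // x y /= -> ->; rewrite subr0.
split=> [|x y [n hn] [m hm]]; first by exists 0; rewrite mulr0z subr0; exact: IH.1.
exists (n - m); rewrite mulrzBr.
rewrite (_ : _ - _ = (x - f *~ n) - (y - f *~ m)); last abel.
exact: IH.2.
Qed.

Lemma mem_zspan F f : f \in F -> zspan F f.
Proof.
elim: F => // g F IH; rewrite inE => /orP[/eqP ->|/IH h].
  by exists 1; rewrite mulr1z subrr; exact: (subgrp_zspan F).1.
by exists 0; rewrite mulr0z subr0.
Qed.

Lemma zspan_min F H : subgrp H -> (forall f, f \in F -> H f) -> zspan F `<=` H.
Proof.
move=> gH; elim: F => [|f F IH] hF x /=; first by move=> ->; exact: gH.1.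
move=> [n hn]; rewrite -(subrK (f *~ n) x); apply: subgrpD => //.
  by apply: IH hn => g gF; apply: hF; rewrite inE gF orbT.
by apply: subgrpMz => //; apply: hF; rewrite inE eqxx.
Qed.

Lemma zspan_sub F F' : {subset F <= F'} -> zspan F `<=` zspan F'.
Proof.
move=> sF; apply: zspan_min; first exact: subgrp_zspan.
by move=> f /sF; exact: mem_zspan.
Qed.

Lemma sumsetS A A' B B' : A `<=` A' -> B `<=` B' -> sumset A B `<=` sumset A' B'.
Proof. by move=> sA sB z [x /sA Ax /sB Bx]; exists x. Qed.

Lemma sumset_mem A B x y : A x -> B y -> sumset A B (x + y).
Proof. by move=> Ax By; exists x => //; rewrite addrAC subrr add0r. Qed.

Lemma sumset_memr D V x : subgrp D -> V x -> sumset D V x.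
Proof. by move=> gD Vx; exists 0; [exact: gD.1|rewrite subr0]. Qed.

Lemma sumset_meml D V x : V 0 -> D x -> sumset D V x.
Proof. by move=> V0 Dx; exists x => //; rewrite subrr. Qed.

Lemma sumset_addl D V x y : subgrp D -> D x -> sumset D V y -> sumset D V (x + y).
Proof.
move=> gD Dx [d Dd Vd]; exists (x + d); first exact: subgrpD.
by rewrite (_ : _ - _ = y - d) //; abel.
Qed.

(** [V] plays the part of a neighbourhood of 0 rather than of a subgroup: its differences fall back
    into [V] up to elements of [E], which [D] absorbs. *)
Lemma subgrp_sumset D E V : subgrp D -> E `<=` D -> V 0 ->
  (forall x y, V x -> V y -> sumset E V (x - y)) -> subgrp (sumset D V).
Proof.
move=> gD sED V0 VB; split; first by apply: sumset_meml => //; exact: gD.1.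
move=> x y [d Dd Vd] [e De Ve]; have [f Ef Vf] := VB _ _ Vd Ve.
rewrite (_ : x - y = (d - e + f) + (x - d - (y - e) - f)); last abel.
by apply: sumset_mem => //; apply: subgrpD; [|exact: gD.2|exact: sED].
Qed.
End Subgroups.

(** * Hilbert's basis argument modulo a set [V] *)

Section NoetherianModules.
Variables (M : zmodType) (I : eqType) (c : I -> M -> M).
Hypothesis cB : forall i x y, c i (x - y) = c i x - c i y.
Hypothesis cC : forall i j x, c i (c j x) = c j (c i x).
Implicit Types (D H V : set M) (F E : seq M) (ts : seq I).

Let c0 i : c i 0 = 0. Proof. by rewrite -[X in c i X](subrr 0) cB subrr. Qed.
Let cN i x : c i (- x) = - c i x.
Proof. by rewrite -sub0r cB c0 sub0r. Qed.
Let cD i x y : c i (x + y) = c i x + c i y.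
Proof. by rewrite -[in LHS](opprK y) cB cN opprK. Qed.

Let iterB i n x y : iter n (c i) (x - y) = iter n (c i) x - iter n (c i) y.
Proof. by elim: n => //= n ->. Qed.
Let iterC i j n x : c j (iter n (c i) x) = iter n (c i) (c j x).
Proof. by elim: n => //= n <-. Qed.

Definition submod ts H :=
  subgrp H /\ forall i, i \in ts -> forall x, H x -> H (c i x).

(** Horner form of the polynomials of degree at most [n] in [t] with coefficients in [D]. *)
Fixpoint hspan (t : M -> M) D n : set M :=
  if n is n'.+1 then [set z | exists2 d, D d & exists2 y, hspan t D n' y & z = d + t y]
  else D.

(** The module generated by [F] over the polynomials in the operators [ts], built one variable at a
    time as in Hilbert's theorem. *)
Fixpoint mspan ts F : set M :=
  if ts is i :: ts' then [set x | exists n, hspan (c i) (mspan ts' F) n x]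
  else zspan F.

Lemma subgrp_hspan i D n : subgrp D -> subgrp (hspan (c i) D n).
Proof.
move=> gD; elim: n => // n [h0 hB]; split=> [|x y].
  by exists 0; [exact: gD.1|exists 0 => //; rewrite c0 addr0].
move=> [d Dd [z hz ->]] [d' Dd' [z' hz' ->]].
exists (d - d'); first exact: gD.2.
by exists (z - z'); [exact: hB|rewrite cB; abel].
Qed.

Lemma hspanS i D n : subgrp D -> hspan (c i) D n `<=` hspan (c i) D n.+1.
Proof.
move=> gD; elim: n => [|n IH] x.
  by exists x => //; exists 0; [exact: gD.1|rewrite c0 addr0].
by move=> [d Dd [y /IH hy ->]]; exists d => //; exists y.
Qed.

Lemma hspan_le i D m n : subgrp D -> (m <= n)%N ->
  hspan (c i) D m `<=` hspan (c i) D n.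
Proof.
move=> gD /subnK <-; elim: (n - m)%N => // k IH.
by apply: subset_trans IH _; rewrite addSn; exact: hspanS.
Qed.

Lemma hspan_base i D n : subgrp D -> D `<=` hspan (c i) D n.
Proof. by move=> gD; exact: (@hspan_le i D 0 n). Qed.

Lemma hspan_act i D n x : subgrp D ->
  hspan (c i) D n x -> hspan (c i) D n.+1 (c i x).
Proof. by move=> gD hx; exists 0; [exact: gD.1|exists x => //; rewrite add0r]. Qed.

Lemma hspan_inv i j D n x : (forall x, D x -> D (c j x)) ->
  hspan (c i) D n x -> hspan (c i) D n (c j x).
Proof.
move=> iD; elim: n x => [|n IH] x /=; first exact: iD.
move=> [d Dd [y hy ->]]; exists (c j d); first exact: iD.
by exists (c j y); [exact: IH|rewrite cD cC].
Qed.

(** The innermost coefficient of the Horner form is the leading one. *)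
Lemma hspan_top i D n z : subgrp D -> hspan (c i) D n.+1 z ->
  exists2 d, D d & hspan (c i) D n (z - iter n.+1 (c i) d).
Proof.
move=> gD; elim: n z => [|n IH] z.
  by move=> [d Dd [y hy ->]]; exists y => //=; rewrite addrK.
move=> [d Dd [y /IH [e De he] ->]]; exists e => //.
exists d => //; exists (y - iter n.+1 (c i) e) => //.
by rewrite cB /= addrA.
Qed.

Lemma submod_mspan ts F : submod ts (mspan ts F).
Proof.
elim: ts => [|i ts [gD iD]]; first by split; [exact: subgrp_zspan|].
split.
  split=> [|x y [m hx] [n hy]]; first by exists 0%N; exact: gD.1.
  exists (maxn m n); apply: (subgrp_hspan _ _ gD).2.
    by apply: hspan_le hx => //; exact: leq_maxl.
  by apply: hspan_le hy => //; exact: leq_maxr.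
move=> j; rewrite inE => /orP[/eqP ->|jts] x [n hx].
  by exists n.+1; exact: hspan_act.
by exists n; apply: hspan_inv => // y; exact: iD.
Qed.

Lemma mem_mspan ts F f : f \in F -> mspan ts F f.
Proof. by elim: ts => [|i ts IH] fF; [exact: mem_zspan|exists 0%N; exact: IH]. Qed.

Lemma mspan_min ts F H : submod ts H -> (forall f, f \in F -> H f) ->
  mspan ts F `<=` H.
Proof.
move=> [gH iH] hF; elim: ts iH => [|i ts IH] iH; first exact: zspan_min.
have {}IH : mspan ts F `<=` H by apply: IH => j jts; apply: iH; rewrite inE jts orbT.
move=> x [n]; elim: n x => [|n IHn] x; first exact: IH.
move=> [d /IH Hd [y /IHn Hy ->]]; apply: subgrpD => //.
by apply: iH; rewrite ?inE ?eqxx.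
Qed.

Lemma mspan_sub ts F F' : {subset F <= F'} -> mspan ts F `<=` mspan ts F'.
Proof.
move=> sF; apply: mspan_min; first exact: submod_mspan.
by move=> f /sF; exact: mem_mspan.
Qed.

Lemma mspan_act ts i F x : mspan ts F x -> mspan ts (map (c i) F) (c i x).
Proof.
move: x; apply: (@mspan_min _ _ [set x | mspan ts (map (c i) F) (c i x)]).
  have [[g0 gB] iD] := submod_mspan ts (map (c i) F).
  split; first by split=> [|x y hx hy] /=; rewrite ?c0 // cB; exact: gB.
  by move=> j jts x /= hx; rewrite cC; exact: iD.
by move=> f fF; apply: mem_mspan; exact: map_f.
Qed.

(** Finitely many generators, over the remaining operators, for the polynomials of degree at most
    [n] in [c i]. *)
Fixpoint htower i F n := if n is n'.+1 then F ++ map (c i) (htower i F n') else F.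

Lemma hspan_tower i ts F n : hspan (c i) (mspan ts F) n `<=` mspan ts (htower i F n).
Proof.
elim: n => // n IH x [d Dd [y /IH hy ->]] /=.
apply: subgrpD; first exact: (submod_mspan _ _).1.
  by apply: mspan_sub Dd => f; rewrite mem_cat => ->.
apply: (@mspan_sub ts (map (c i) (htower i F n))); last exact: mspan_act.
by move=> f; rewrite mem_cat orbC => ->.
Qed.

Lemma sub_htower i F n : {subset F <= htower i F n}.
Proof. by case: n => // n f fF; rewrite mem_cat fF. Qed.

Definition directed (J : Type) (Ms : J -> set M) :=
  forall i j, exists k, Ms i `<=` Ms k /\ Ms j `<=` Ms k.

(** The ascending chain condition for a family, tested only on [X]; this form makes sense when [X]
    is merely a subset such as [zspan F + V]. *)
Definition noetherian_on (J : Type) (Ms : J -> set M) (X : set M) :=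
  exists j, forall k, Ms k `&` X `<=` Ms j.

Definition noetherian ts := forall (J : Type) (j0 : J) (Ms : J -> set M),
  directed Ms -> (forall j, submod ts (Ms j)) ->
  forall F, noetherian_on Ms (mspan ts F).

(* The leading coefficients in [c i] of the members of the family form a
   directed family of submodules over the remaining operators. *)
Lemma noetherian_step (J : Type) (j0 : J) (Ms : J -> set M) i ts V E F :
  directed Ms -> (forall j, submod (i :: ts) (Ms j)) ->
  V 0 -> (forall x y, V x -> V y -> sumset (zspan E) V (x - y)) ->
  (forall j, j \in i :: ts -> forall x, V x -> sumset (zspan E) V (c j x)) ->
  noetherian ts ->
  (forall F, {subset E <= F} -> noetherian_on Ms (sumset (mspan ts F) V)) ->
  {subset E <= F} -> noetherian_on Ms (sumset (mspan (i :: ts) F) V).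
Proof.
move=> dirM subM V0 VB Vc noe base sEF.
set D := mspan ts F; have [gD iD] : submod ts D := submod_mspan ts F.
pose A n := sumset (hspan (c i) D n) V.
have sED : zspan E `<=` D.
  by apply: zspan_min => // f /sEF; exact: mem_mspan.
have gA n : subgrp (A n).
  apply: (subgrp_sumset _ _ V0 VB); first exact: subgrp_hspan.
  by apply: subset_trans sED _; exact: hspan_base.
have A_le m n : (m <= n)%N -> A m `<=` A n.
  by move=> mn; apply: sumsetS => //; exact: hspan_le.
have A_act n x : A n x -> A n.+1 (c i x).
  move=> [d hd Vd]; rewrite (_ : c i x = c i d + c i (x - d)); last by rewrite cB; abel.
  apply: sumset_addl; first exact: subgrp_hspan; first exact: hspan_act.
  apply: sumsetS (Vc i _ _ Vd) => //; last by rewrite inE eqxx.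
  by apply: subset_trans sED _; exact: hspan_base.
have A_inv j n x : j \in ts -> A n x -> A n (c j x).
  move=> jts [d hd Vd]; rewrite (_ : c j x = c j d + c j (x - d)); last by rewrite cB; abel.
  apply: sumset_addl; first exact: subgrp_hspan.
    by apply: hspan_inv hd => y; exact: iD.
  apply: sumsetS (Vc j _ _ Vd) => //; last by rewrite inE jts orbT.
  by apply: subset_trans sED _; exact: hspan_base.
have gM j := (subM j).1.
have Mi j x : Ms j x -> Ms j (c i x) by apply: (subM j).2; rewrite inE eqxx.
pose U (p : nat * J) := [set d | sumset (Ms p.2) (A p.1) (iter p.1.+1 (c i) d)].
have U_le m n j k : (m <= n)%N -> Ms j `<=` Ms k -> U (m, j) `<=` U (n, k).
  move=> mn jk d hd; have {hd} : U (m, k) d by apply: sumsetS hd.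
  move/subnK: mn => <-; elim: (n - m)%N => // q IH hd.
  rewrite addSn; have [y My Ay] := IH hd.
  by exists (c i y); [exact: Mi|rewrite /= -cB; exact: A_act].
have dirU : directed U.
  move=> [m j] [n k]; have [l [jl kl]] := dirM j k.
  by exists (maxn m n, l); split; apply: U_le => //; rewrite ?leq_maxl ?leq_maxr.
have subU p : submod ts (U p).
  split.
    split=> [|x y]; first by rewrite /U /= -[0](subrr 0) iterB cB subrr;
      exists 0; [exact: (gM _).1|rewrite subr0; exact: (gA _).1].
    move=> [u Mu Au] [v Mv Av]; exists (u - v); first exact: (gM _).2.
    rewrite iterB (_ : _ - _ = (iter p.1.+1 (c i) x - u) - (iter p.1.+1 (c i) y - v)); last abel.
    exact: (gA _).2.
  move=> j jts x [u Mu Au]; exists (c j u).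
    by apply: (subM _).2 => //; rewrite inE jts orbT.
  by rewrite -iterC -cB; exact: A_inv.
(* Degrees above [n0] are governed by the stable leading coefficients; degrees up to [n0] fall under
   [base], applied to the finite list [htower i F n0]. *)
have [[n0 k0] hU] := noe _ (0%N, j0) U dirU subU F.
have [k1 hk1] := base (htower i F n0) (fun f fE => sub_htower _ _ (sEF f fE)).
have [k2 [k02 k12]] := dirM k0 k1.
have low k : Ms k `&` A n0 `<=` Ms k2.
  move=> x [Mx Ax]; apply/k12/(hk1 k); split=> //.
  by apply: sumsetS Ax => //; exact: hspan_tower.
(* Induction on the degree: [v] below is a member of [Ms k0] with the same leading term as [x], so
   that [x - v] has smaller degree. *)
have key n k : Ms k `&` A (n + n0)%N `<=` Ms k2.
  elim: n k => [|n IH] k x; first exact: low.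
  move=> [Mx [y hy Vy]]; rewrite addSn in hy.
  have [d Dd hd] := hspan_top gD hy.
  set m := (n + n0)%N in hd.
  set e := iter m.+1 (c i) d.
  have Axe : A m (x - e).
    by exists (y - e) => //; rewrite (_ : _ - _ = x - y) //; abel.
  have [u Mu Au] : U (n0, k0) d.
    apply: (hU (m, k)); split=> //; exists x => //=.
    rewrite -/(iter m.+1 (c i) d) -/e (_ : e - x = - (x - e)); last abel.
    exact: subgrpN.
  pose v := iter n (c i) u.
  have Mv : Ms k0 v by rewrite /v; elim: (n) => //= q; exact: Mi.
  have Aev : A m (e - v).
    rewrite /e /v /m -addnS iterD -iterB.
    elim: (n) => [|q IHq] //=.
    by rewrite addSn; apply: A_act.
  have [l [kl k0l]] := dirM k k0.
  rewrite -(subrK v x); apply: subgrpD => //; last exact: k02.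
  apply: (IH l); split; first by apply: (gM l).2; [exact: kl|exact: k0l].
  rewrite (_ : x - v = (x - e) + (e - v)); last abel.
  exact: subgrpD.
exists k2 => k x [Mx [y [n hy] Vy]]; apply: (key n k); split=> //.
by exists y => //; apply: hspan_le hy => //; exact: leq_addr.
Qed.

(** The coefficients of [f] occurring in the family modulo the other generators form an ideal of the
    integers. Euclidean division by its least positive member, if there is one, reduces an element
    to the span of the other generators. *)
Lemma noetherian_int : noetherian [::].
Proof.
move=> J j0 Ms dirM subM F; rewrite /mspan.
have gM j := (subM j).1.
elim: F => [|f F [j1 IH]]; first by exists j0 => k x [_ /= ->]; exact: (gM j0).1.
have gZ := subgrp_zspan F.
(* The shift [n.+1] keeps the multiple positive, so the minimum taken below is a valid divisor. *)
pose Q n := exists j, sumset (Ms j) (zspan F) (f *+ n.+1).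
have [hQ|hQ] := pselect (exists n, `[<Q n>]); last first.
  exists j1 => k x [Mx [n hn]]; apply: (IH k); split=> //.
  suff n0 : n = 0 by rewrite n0 mulr0z subr0 in hn.
  apply: contra_notP hQ => n0.
  have fn : sumset (Ms k) (zspan F) (f *~ n).
    exists x => //; rewrite (_ : _ - x = - (x - f *~ n)); last abel.
    exact: subgrpN.
  case: n n0 {hn} fn => [[|n] // _ fn|n _ fn]; exists n; apply/asboolP; exists k.
    by rewrite pmulrn.
  move: fn => [y My hy]; exists (- y); first exact: subgrpN.
  rewrite (_ : _ - _ = - (f *~ Negz n - y)); last first.
    by rewrite NegzE mulrNz -pmulrn; abel.
  exact: subgrpN.
pose n0 := ex_minn hQ; have [j2 [u Mu hu]] : Q n0.
  by rewrite /n0; case: ex_minnP => n /asboolP.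
have n0min n : Q n -> (n0 <= n)%N.
  by rewrite /n0; case: ex_minnP => m _ h /asboolP; exact: h.
have [j3 [j13 j23]] := dirM j1 j2.
exists j3 => k x [Mx [n hn]].
have [l [kl jl]] := dirM k j2.
set q := (n %/ n0.+1)%Z.
have xu : zspan F (x - u *~ q - f *~ (n %% n0.+1)%Z).
  rewrite (_ : x - _ - _ = (x - f *~ n) + (f *+ n0.+1 - u) *~ q); last first.
    have -> : f *~ n = f *+ n0.+1 *~ q + f *~ (n %% n0.+1)%Z.
      by rewrite {1}(divz_eq n n0.+1) mulrzDr pmulrn -mulrzA [(n0.+1 : int) * _]mulrC.
    by rewrite mulrzBl; abel.
  by apply: subgrpD => //; exact: subgrpMz.
have Mxu : Ms l (x - u *~ q).
  by apply: (gM l).2; [exact: kl|apply: subgrpMz => //; exact: jl].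
rewrite -(subrK (u *~ q) x); apply: subgrpD => //; last first.
  by apply: subgrpMz => //; exact: j23.
apply/j13/(IH l); split=> //.
(* A nonzero remainder would be a smaller positive coefficient. *)
have : (0 <= (n %% n0.+1)%Z < n0.+1)%R by rewrite modz_ge0 // ltz_pmod.
move: xu; case: (n %% n0.+1)%Z => [[|r]|r] //; first by rewrite mulr0z subr0.
move=> xu /andP[_ rn]; have : Q r.
  exists l; exists (x - u *~ q) => //.
  rewrite pmulrn (_ : _ - _ = - (x - u *~ q - f *~ r.+1)); last abel.
  exact: subgrpN.
by move/n0min; lia.
Qed.

(** The inductive step is used with [V] reduced to 0 and [E] empty. *)
Lemma noetherianP ts : noetherian ts.
Proof.
elim: ts => [|i ts IH]; first exact: noetherian_int.
move=> J j0 Ms dirM subM F.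
have zz : @sumset M (zspan [::]) [set 0] 0 by exists 0 => //=; rewrite subr0.
have [j hj] : noetherian_on Ms (sumset (mspan (i :: ts) F) [set 0]).
  apply: (@noetherian_step _ j0 Ms i ts [set 0] [::]) => //.
  - by move=> x y /= -> ->; rewrite subr0.
  - by move=> j _ x /= ->; rewrite c0.
  - move=> F' _; have [|j hj] := IH _ j0 Ms dirM _ F'.
      by move=> j; split; [exact: (subM j).1|move=> k kts; apply: (subM j).2;
         rewrite inE kts orbT].
    exists j => k x [Mx [y hy /= /eqP]]; rewrite subr_eq0 => /eqP xy.
    by apply: (hj k); split=> //; rewrite xy.
by exists j => k x [Mx hx]; apply: (hj k); split=> //; exists x => //=; rewrite subrr.
Qed.

(** The same induction on the operators, started from the hypothesis on the sets [zspan F + V]; the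
    leading coefficients are handled by the exact statement [noetherianP]. *)
Theorem noetherian_mod (J : Type) (j0 : J) (Ms : J -> set M) ts V E :
  directed Ms -> (forall j, submod ts (Ms j)) ->
  V 0 -> (forall x y, V x -> V y -> sumset (zspan E) V (x - y)) ->
  (forall j, j \in ts -> forall x, V x -> sumset (zspan E) V (c j x)) ->
  (forall F, {subset E <= F} -> noetherian_on Ms (sumset (zspan F) V)) ->
  forall F, {subset E <= F} -> noetherian_on Ms (sumset (mspan ts F) V).
Proof.
move=> dirM + V0 VB + base; elim: ts => [|i ts IH] subM Vc //.
move=> F sEF; apply: (@noetherian_step _ j0 Ms i ts V E) => //.
  exact: noetherianP.
apply: IH => [j|j jts]; last by apply: Vc; rewrite inE jts orbT.
by split; [exact: (subM j).1|move=> k kts; apply: (subM j).2; rewrite inE kts orbT].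
Qed.
End NoetherianModules.

(** * Totally bounded sets and bounded subgroups of an abelian group *)

Lemma seq_bounded_choice (T : eqType) (s : seq T) (P : T -> nat -> Prop) :
  (forall y m n, (m <= n)%N -> P y m -> P y n) ->
  (forall y, y \in s -> exists n, P y n) ->
  exists n, forall y, y \in s -> P y n.
Proof.
move=> mono; elim: s => [|a s IH] hs; first by exists 0%N.
have [|n hn] := IH; first by move=> y ys; apply: hs; rewrite inE ys orbT.
have [m hm] := hs a (mem_head _ _).
exists (maxn m n) => y; rewrite inE => /orP[/eqP ->|/hn].
  by apply: mono hm; exact: leq_maxl.
by apply: mono; exact: leq_maxr.
Qed.

Section Bounded.
Variables (M : zmodType) (nb : set (set M)).
Hypothesis nb0 : forall V, nb V -> V 0.
Hypothesis nb_half : forall V, nb V ->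
  exists2 V', nb V' & forall x y, V' x -> V' y -> V (x - y).
Implicit Types (K V H : set M) (x y : M) (xs s : seq M).

(** Total boundedness for the system [nb] of neighbourhoods of 0; it stands in for relative
    compactness. *)
Definition bounded K := forall V, nb V ->
  exists s : seq M, forall x, K x -> exists2 y, y \in s & V (x - y).

Lemma nb_split V : nb V -> exists2 V', nb V' &
  forall x y, V' x -> V' y -> V (x - y) /\ V (x + y).
Proof.
move=> nV; have [V1 nV1 h1] := nb_half nV; have [V2 nV2 h2] := nb_half nV1.
have s1 x : V2 x -> V1 x by move=> hx; rewrite -[x]subr0; apply: h2 => //; exact: nb0.
exists V2 => // x y hx hy; split; first by apply: h1; exact: s1.
rewrite -[y]opprK; apply: h1; first exact: s1.
by rewrite -sub0r; apply: h2 => //; exact: nb0.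
Qed.

Lemma boundedS K K' : K `<=` K' -> bounded K' -> bounded K.
Proof. by move=> sK bK V /bK[s hs]; exists s => x /sK /hs. Qed.

Lemma bounded_seq s : bounded [set x | x \in s].
Proof. by move=> V nV; exists s => x xs; exists x => //; rewrite subrr; exact: nb0. Qed.

Lemma bounded_sumset K K' : bounded K -> bounded K' -> bounded (sumset K K').
Proof.
move=> bK bK' V /nb_split[V' nV' hV'].
have [s hs] := bK _ nV'; have [s' hs'] := bK' _ nV'.
exists [seq y + y' | y <- s, y' <- s'] => x [k /hs[y ys hy] /hs'[y' ys' hy']].
exists (y + y'); first by apply/allpairsP; exists (y, y').
rewrite (_ : _ - _ = (k - y) + (x - k - y')); last abel.
exact: (hV' _ _ hy hy').2.
Qed.

Lemma boundedN K : bounded K -> bounded [set x | K (- x)].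
Proof.
move=> bK V /nb_half[V' nV' hV']; have [s hs] := bK _ nV'.
exists (map -%R s) => x /hs[y ys hy]; exists (- y); first by apply: map_f.
rewrite (_ : _ - _ = 0 - (- x - y)); last abel.
by apply: hV' => //; exact: nb0.
Qed.

Lemma boundedU K K' : bounded K -> bounded K' -> bounded (K `|` K').
Proof.
move=> bK bK' V nV; have [s hs] := bK _ nV; have [s' hs'] := bK' _ nV.
exists (s ++ s') => x [/hs|/hs'] [y ys hy]; exists y => //.
  by rewrite mem_cat ys.
by rewrite mem_cat ys orbT.
Qed.

(** Each centre is replaced by a point of [K] near it, which costs a halving of the neighbourhood; a
    centre without such a point is dropped. *)
Lemma bounded_inner K V : bounded K -> nb V -> exists s : seq M,
  (forall y, y \in s -> K y) /\ forall x, K x -> exists2 y, y \in s & V (x - y).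
Proof.
move=> bK /nb_half[V' nV' hV']; have [s hs] := bK _ nV'.
suff [s' [s'K hs']] : exists s' : seq M, (forall y, y \in s' -> K y) /\
    forall x, K x -> (exists2 y, y \in s & V' (x - y)) -> exists2 y, y \in s' & V (x - y).
  by exists s'; split=> // x Kx; apply: hs' => //; exact: hs.
elim: s {hs} => [|a s [s' [s'K hs']]]; first by exists [::]; split=> // x _ [].
have [[k Kk hk]|nk] := pselect (exists2 k, K k & V' (k - a)).
  exists (k :: s'); split=> [y|x Kx]; first by rewrite inE => /orP[/eqP ->|/s'K].
  move=> [y]; rewrite inE => /orP[/eqP ->|ys] hy.
    exists k; rewrite ?inE ?eqxx // (_ : x - k = (x - a) - (k - a)); last abel.
    exact: hV'.
  by have [|z zs hz] := hs' x Kx; [exists y|exists z; rewrite // inE zs orbT].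
exists s'; split=> // x Kx [y]; rewrite inE => /orP[/eqP ->|ys] hy.
  by case: nk; exists x.
by apply: hs' => //; exists y.
Qed.

Variable V0 : set M.
Hypotheses (nV0 : nb V0) (bV0 : bounded V0).

(* Weil's recurrence argument: if the multiples of [x] return infinitely often
   to a bounded set modulo [Y], the return times have bounded gaps. *)
Lemma recurrent_multiples Y K x : subgrp Y -> bounded K ->
  (forall N, exists2 n, (N <= n)%N & sumset Y K (x *+ n)) ->
  exists2 K', bounded K' & forall n : int, sumset Y K' (x *~ n).
Proof.
move=> gY bK rec.
(* Pigeonhole: two return times far apart fall in the same small translate [p + V'], and their
   difference returns to [V]. *)
have ret V N : nb V -> exists2 n, (N <= n)%N & sumset Y V (x *+ n).
  move=> /nb_half[V' nV' hV']; have [s hs] := bK _ nV'.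
  apply: contrapT => noret.
  pose P (p : M) B := forall n, sumset Y [set k | V' (k - p)] (x *+ n) -> (n <= B)%N.
  have [|p ps|B hB] := @seq_bounded_choice _ s P.
  - by move=> p m n mn hp k /hp km; exact: leq_trans mn.
  - apply: contrapT => nB; apply: noret.
    have [n0 [y0 Yy0 /= h0]] : exists n, sumset Y [set k | V' (k - p)] (x *+ n).
      by apply: contrapT => h; apply: nB; exists 0%N => n hn; case: h; exists n.
    have [n1 [y1 Yy1 /= h1] n1N] :
        exists2 n, sumset Y [set k | V' (k - p)] (x *+ n) & (n0 + N <= n)%N.
      apply: contrapT => h; apply: nB; exists (n0 + N)%N => n hn.
      by rewrite leqNgt; apply/negP => /ltnW ?; apply: h; exists n.
    exists (n1 - n0)%N; first by lia.
    exists (y1 - y0); first exact: gY.2.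
    rewrite mulrnBr; last by lia.
    rewrite (_ : _ - _ = (x *+ n1 - y1 - p) - (x *+ n0 - y0 - p)); last abel.
    exact: hV'.
  have [n Bn [y Yy /hs[p ps hp]]] := rec B.+1.
  by have := hB p ps n (ex_intro2 _ _ y Yy hp); rewrite leqNgt Bn.
have [V1 nV1 hV1] := nb_split nV0.
(* [Z] consists of the elements of [V0] congruent to multiples of [x] modulo [Y]. Near each of its
   finitely many centres one positive step [k] leads back to [Y + V0]; the largest of these steps
   bounds the gaps. *)
pose Z := [set v | V0 v /\ exists n : int, Y (v - x *~ n)].
have bZ : bounded Z by apply: boundedS bV0 => v [].
have [s [sZ hs]] := bounded_inner bZ nV1.
pose P (p : M) B := exists k : nat, [/\ (0 < k)%N, (k <= B)%N &
  forall v, V1 (v - p) -> sumset Y V0 (v + x *+ k)].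
have [|p ps|B hB] := @seq_bounded_choice _ s P.
- by move=> p m n mn [k [k0 km hk]]; exists k; split=> //; exact: leq_trans mn.
- have [V0p [n Yp]] := sZ p ps.
  (* [m] exceeds the absolute value of [n], so the step [k = m - n] is positive. *)
  have [m mn [y Yy hy]] := ret V1 (absz n).+1 nV1.
  have [k kE] : exists k : nat, (k : int) = m%:Z - n by exists (absz (m%:Z - n)); lia.
  exists k, k; split=> [|//|v hv]; first by lia.
  exists (p - x *~ n + y); first exact: subgrpD.
  rewrite [x *+ k]pmulrn kE mulrzBr -pmulrn.
  rewrite (_ : _ - _ = (v - p) + (x *+ m - y)); last abel.
  exact: (hV1 _ _ hv hy).2.
have gap n : exists2 j, (j <= B)%N & sumset Y V0 (x *+ (n + j)).
  elim: n => [|n [[|j] jB hj]].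
  - by exists 0%N => //; exists 0; rewrite ?subrr ?mulr0n; [exact: gY.1|exact: nb0].
  - move: hj => [y Yy Vy]; rewrite addn0 in Vy.
    have Zv : Z (x *+ n - y).
      split=> //; exists n; rewrite -pmulrn (_ : _ - _ = - y); last abel.
      exact: subgrpN.
    have [p ps hp] := hs _ Zv; have [k [k0 kB hk]] := hB p ps.
    exists k.-1; first by lia.
    have -> : x *+ (n.+1 + k.-1) = y + (x *+ n - y + x *+ k).
      have -> : (n.+1 + k.-1 = n + k)%N by lia.
      by rewrite mulrnDr; abel.
    by apply: sumset_addl => //; exact: hk.
  - by exists j; [exact: ltnW|rewrite addSnnS].
pose K1 := sumset V0 [set - y | y in [set y | y \in [seq x *+ j | j <- iota 0 B.+1]]].
have bK1 : bounded K1.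
  apply: bounded_sumset => //.
  apply: boundedS (bounded_seq (map -%R [seq x *+ j | j <- iota 0 B.+1])).
  by move=> _ [y ys <-]; apply/mapP; exists y.
have natK1 n : sumset Y K1 (x *+ n).
  have [j jB [y Yy Vy]] := gap n; exists y => //.
  exists (x *+ (n + j) - y) => //; exists (x *+ j).
    by apply/mapP; exists j => //; rewrite mem_iota add0n ltnS.
  by rewrite mulrnDr; abel.
exists (K1 `|` [set z | K1 (- z)]); first by apply: boundedU => //; exact: boundedN.
case=> n.
  by rewrite -pmulrn; apply: sumsetS (natK1 n) => // z; left.
have [y Yy Ky] := natK1 n.+1; exists (- y); first exact: subgrpN.
right => /=; rewrite NegzE mulrNz -pmulrn (_ : - _ = x *+ n.+1 - y) //; abel.
Qed.

(** Induction on the generators. If the multiples of [x] recur modulo [Y], they stay in a bounded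
    set modulo [Y], and [x] is absorbed into [K]. Otherwise the coefficient of [x] in elements of
    [H] can be bounded by a [d] independent of [H], so finitely many multiples of [x] suffice. *)
Theorem bounded_subgroups xs K : bounded K -> exists2 K', bounded K' &
  forall H, subgrp H -> bounded H -> H `<=` sumset (zspan xs) K -> H `<=` K'.
Proof.
elim: xs K => [|x xs IH] K bK.
  exists K => // H _ _ sH h /sH [z /= ->]; by rewrite subr0.
set Y := zspan xs; have gY : subgrp Y := subgrp_zspan xs.
pose K1 := sumset K V0; have bK1 : bounded K1 by exact: bounded_sumset.
(* [K2] is [K1 - (K1 + K1)], the error made when the coefficient of [h + h] is compared with twice
   that of [h]; [K3] makes it symmetric. *)
pose K2 := sumset K1 [set z | sumset K1 K1 (- z)].
have bK2 : bounded K2.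
  by apply: bounded_sumset => //; apply: boundedN; exact: bounded_sumset.
pose K3 := K2 `|` [set z | K2 (- z)].
have bK3 : bounded K3 by apply: boundedU => //; exact: boundedN.
have [rec|nrec] := pselect (forall N, exists2 n, (N <= n)%N & sumset Y K3 (x *+ n)).
  have [K4 bK4 hK4] := recurrent_multiples gY bK3 rec.
  have [K' bK' hK'] := IH (sumset K4 K) (bounded_sumset bK4 bK).
  exists K' => // H gH bH sH; apply: hK' => // h /sH [z [n Yn] Kz].
  have [y Yy Ky] := hK4 n.
  exists (z - x *~ n + y); first exact: subgrpD.
  exists (x *~ n - y) => //.
  by rewrite (_ : _ - _ = h - z) //; abel.
have [d hd] : exists d : nat, forall n : nat, sumset Y K3 (x *+ n) -> (n <= d)%N.
  apply: contrapT => h; apply: nrec => N; apply: contrapT => h'; apply: h.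
  by exists N => n hn; rewrite leqNgt; apply/negP => /ltnW ?; apply: h'; exists n.
have {}hd (n : int) : sumset Y K2 (x *~ n) -> (absz n <= d)%N.
  case: n => n [y Yy Ky]; apply: hd; [exists y => //|exists (- y); first exact: subgrpN].
    by left.
  right => /=; rewrite NegzE mulrNz -pmulrn in Ky.
  by rewrite (_ : - _ = - (x *+ n.+1) - y) //; abel.
pose S := [seq x *~ (Posz i - Posz d) | i <- iota 0 (d + d).+1].
have [K' bK' hK'] := IH _ (bounded_sumset (bounded_seq S) bK1).
exists K' => // H gH bH sH; apply: hK' => //.
pose P B := forall h, H h -> exists2 n : int, (absz n <= B)%N & sumset Y K1 (h - x *~ n).
(* A bound depending on [H] exists because finitely many translates of [V0] cover [H]; hence the
   enlargement of [K] to [K1]. *)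
have exP : exists B, P B.
  have [s [sHs hs]] := bounded_inner bH nV0.
  pose Q (p : M) B := exists2 n : int, (absz n <= B)%N & sumset Y K (p - x *~ n).
  have [|p ps|B hB] := @seq_bounded_choice _ s Q.
  - by move=> p m n mn [k km hk]; exists k => //; exact: leq_trans mn.
  - have [z [n Yn] Kz] := sH _ (sHs p ps).
    exists (absz n), n => //; exists (z - x *~ n) => //.
    by rewrite (_ : _ - _ = p - z) //; abel.
  exists B => h Hh; have [p ps hp] := hs h Hh; have [n nB [y Yy Ky]] := hB p ps.
  exists n => //; exists y => //; exists (p - x *~ n - y) => //.
  by rewrite (_ : _ - _ = h - p) //; abel.
have exPb : exists B, `[<P B>] by case: exP => B hB; exists B; apply/asboolP.
(* Comparing [h] with [h + h] improves a bound [B] to [(B + d) / 2]. *)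
have Pd : P d.
  have [B /asboolP hB Bmin] := ex_minnP exPb.
  suff Bd : (B <= d)%N.
    by move=> h /hB[n nB hn]; exists n => //; exact: leq_trans Bd.
  rewrite leqNgt; apply/negP => dB.
  suff /asboolP/Bmin : P B.-1 by lia.
  move=> h Hh; have [n nB [y Yy Ky]] := hB h Hh.
  have [m mB [z Yz Kz]] := hB _ (subgrpD gH Hh Hh).
  exists n; last by exists y.
  suff /hd : sumset Y K2 (x *~ (n + n - m)) by lia.
  exists (z - (y + y)); first by apply: gY.2 => //; exact: subgrpD.
  exists (h + h - x *~ m - z) => //; rewrite mulrzBr mulrzDr.
  exists (h - x *~ n - y) => //.
  by rewrite (_ : _ - _ = h - x *~ n - y) //; abel.
move=> h /Pd[n nd [y Yy Ky]]; exists y => //; exists (x *~ n).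
  rewrite /= (_ : n = Posz (absz (n + d%:Z)) - Posz d); last by lia.
  by apply/mapP; exists (absz (n + d%:Z)); rewrite // mem_iota; lia.
by rewrite (_ : _ - _ = h - x *~ n - y) //; abel.
Qed.
End Bounded.

(** * Dickson's lemma and the lexicographic order on exponents *)

Section Dickson.

(** The next index is a place where [f] attains its minimum over the remaining tail. *)
Lemma nondecreasing_subsequence (f : nat -> nat) : exists2 g : nat -> nat,
  (forall k, g k < g k.+1)%N & forall k, (f (g k) <= f (g k.+1))%N.
Proof.
have pmin N : exists n, (N <= n)%N /\ forall k, (N <= k)%N -> (f n <= f k)%N.
  have ex : exists v, `[<exists2 n, (N <= n)%N & f n = v>].
    by exists (f N); apply/asboolP; exists N.
  have [v /asboolP[n Nn <-] hmin] := ex_minnP ex.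
  by exists n; split=> // k Nk; apply: hmin; apply/asboolP; exists k.
have [p hp] := choice pmin.
exists (fun k => iter k (fun m => p m.+1) (p 0%N)) => k /=.
  exact: (hp _).1.
have step N : (f (p N) <= f (p (p N).+1))%N.
  by apply: (hp N).2; exact: leq_trans (hp N).1 (ltnW (hp (p N).+1).1).
by case: k => [|k]; exact: step.
Qed.

Lemma increasing_homo (g : nat -> nat) :
  (forall k, g k < g k.+1)%N -> forall m n, (m < n)%N -> (g m < g n)%N.
Proof.
move=> hg m n; elim: n => // n IH; rewrite ltnS leq_eqVlt => /orP[/eqP ->//|/IH].
by move/ltn_trans; apply.
Qed.

Lemma nondecreasing_homo (f : nat -> nat) :
  (forall k, f k <= f k.+1)%N -> forall m n, (m <= n)%N -> (f m <= f n)%N.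
Proof.
move=> hf m n /subnK <-; elim: (n - m)%N => // k IH.
by rewrite addSn; exact: leq_trans IH (hf _).
Qed.

Lemma dickson (fs : nat -> nat -> nat) m : exists2 g : nat -> nat,
  (forall k, g k < g k.+1)%N &
  forall i, (i < m)%N -> forall k l, (k <= l)%N -> (fs i (g k) <= fs i (g l))%N.
Proof.
elim: m => [|m [g hg IH]]; first by exists id.
have [h hh hf] := nondecreasing_subsequence (fs m \o g).
exists (g \o h) => [k|i]; first exact: (@increasing_homo g hg).
rewrite ltnS leq_eqVlt => /orP[/eqP ->|im] k l kl.
  exact: (@nondecreasing_homo (fs m \o g \o h) hf).
by apply: IH => //; apply: nondecreasing_homo kl => n; exact: ltnW.
Qed.

Fixpoint lexlt (u w : seq nat) : bool :=
  match u, w with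
  | a :: u', b :: w' => (a < b)%N || ((a == b) && lexlt u' w')
  | [::], _ :: _ => true
  | _, [::] => false
  end.

Definition lexle u w := (u == w) || lexlt u w.

Lemma lexltxx u : lexlt u u = false.
Proof. by elim: u => //= a u ->; rewrite ltnn andbF. Qed.

Lemma lexlt_trans : transitive lexlt.
Proof.
move=> w u v; elim: u w v => [|a u IH] [|b w] [|d v] //=.
case/orP=> [ab|/andP[/eqP -> uw]]; case/orP=> [bd|/andP[/eqP <- wv]].
- by rewrite (ltn_trans ab bd).
- by rewrite ab.
- by rewrite bd.
- by rewrite eqxx (IH _ _ uw wv) orbT.
Qed.

Lemma lexle_total : total lexle.
Proof.
rewrite /lexle; elim=> [|a u IH] [|b w] //=.
rewrite !eqseq_cons; case: (ltngtP a b) => //= _; exact: IH.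
Qed.

Lemma lexle_trans : transitive lexle.
Proof.
move=> w u v; rewrite /lexle => /orP[/eqP ->//|uw] /orP[/eqP <-|wv].
  by rewrite uw orbT.
by rewrite (lexlt_trans uw wv) orbT.
Qed.

Lemma lexlt_incr u w k : size u = size w -> (k < size u)%N ->
  lexlt u w -> lexlt (incr_nth u k) (incr_nth w k).
Proof.
elim: u w k => [|a u IH] [|b w] [|k] //= [] suw kn.
by case/orP=> [->//|/andP[-> /(IH _ _ suw kn) ->]]; rewrite orbT.
Qed.

Lemma size_incr_nth_lt (w : seq nat) k : (k < size w)%N -> size (incr_nth w k) = size w.
Proof. by move=> kw; rewrite size_incr_nth kw. Qed.

Lemma sumn_incr w k : (k < size w)%N -> sumn (incr_nth w k) = (sumn w).+1.
Proof. by elim: w k => [|a w IH] [|k] //= /IH ->; rewrite addnS. Qed.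

(** This allows a climb from [u] to [w] by unit increments that stays below [w]. *)
Lemma exists_incr_le (u w : seq nat) : size u = size w ->
  (forall k, (k < size u)%N -> (nth 0 u k <= nth 0 w k)%N) -> u != w ->
  exists2 k, (k < size u)%N &
    forall l, (l < size u)%N -> (nth 0 (incr_nth u k) l <= nth 0 w l)%N.
Proof.
elim: u w => [|a u IH] [|b w] //= [suw] hle; rewrite eqseq_cons negb_and.
have [ab|ab _] /= := eqVneq a b.
  rewrite -{}ab in hle *.
  move=> uw; have [|k ku hk] := IH w suw _ uw; first by move=> k; exact: (hle k.+1).
  by exists k.+1 => // -[|l] //=; exact: hk.
exists 0%N => // -[|l] //= lu; last exact: (hle l.+1).
by rewrite ltn_neqAle ab; exact: (hle 0%N).
Qed.

Lemma sumn_le (u w : seq nat) : size u = size w ->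
  (forall k, (k < size u)%N -> (nth 0 u k <= nth 0 w k)%N) -> (sumn u <= sumn w)%N.
Proof.
elim: u w => [|a u IH] [|b w] //= [suw] hle; apply: leq_add; first exact: (hle 0%N).
by apply: IH => // k; exact: (hle k.+1).
Qed.

Fixpoint exponents m n : seq (seq nat) :=
  if m is m'.+1 then [seq a :: w | a <- iota 0 n.+1, w <- exponents m' n] else [:: [::]].

Lemma mem_exponents w n : (sumn w <= n)%N -> w \in exponents (size w) n.
Proof.
elim: w => // a w IH hn; apply: allpairs_f.
  by rewrite mem_iota add0n ltnS; apply: leq_trans hn; exact: leq_addr.
by apply: IH; apply: leq_trans hn; exact: leq_addl.
Qed.

Lemma count_lt (T : eqType) (a b : pred T) s r :
  (forall x, a x -> b x) -> r \in s -> b r -> ~~ a r -> (count a s < count b s)%N.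
Proof.
move=> ab; elim: s => //= x s IH; rewrite inE => /orP[/eqP <- br nar|rs br nar].
  by rewrite br (negbTE nar) add0n add1n ltnS; exact: sub_count.
have : (a x <= b x)%N by case: (a x) (ab x) => // ->.
by have := IH rs br nar; lia.
Qed.
End Dickson.

(** * Stabilisation of a descending filtration under commuting operators *)

Section DescendingFiltration.
Variables (M : zmodType) (I : eqType) (i0 : I) (c : I -> M -> M).
Hypothesis cB : forall i x y, c i (x - y) = c i x - c i y.
Hypothesis cC : forall i j x, c i (c j x) = c j (c i x).
Variables (hs : seq I) (L : nat -> set M).
Hypothesis gL : forall n, subgrp (L n).
Hypothesis LS : forall n x, L n.+1 x <-> L n x /\ forall i, i \in hs -> L n (c i x).
Variable reps : seq M.
Hypothesis repsP : forall x, L 0%N x -> exists2 y, y \in reps & L 1%N (x - y).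
Implicit Types (w u : seq nat) (x y : M).

Fixpoint mono (ts : seq I) w x : M :=
  match ts, w with
  | i :: ts', a :: w' => iter a (c i) (mono ts' w' x)
  | _, _ => x
  end.

(** The sum over [i] in [ts] of the images of [H] under [c i - 1]. *)
Fixpoint dspan (ts : seq I) (H : set M) : set M :=
  if ts is i :: ts' then [set z | exists2 l, H l & dspan ts' H (z - (c i l - l))]
  else [set 0].

Let iterB i n x y : iter n (c i) (x - y) = iter n (c i) x - iter n (c i) y.
Proof. by elim: n => //= n ->. Qed.
Let iterC i j n x : c j (iter n (c i) x) = iter n (c i) (c j x).
Proof. by elim: n => //= n <-. Qed.
Let c0 i : c i 0 = 0. Proof. by rewrite -[X in c i X](subrr 0) cB subrr. Qed.

Lemma monoB ts w x y : mono ts w (x - y) = mono ts w x - mono ts w y.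
Proof. by elim: ts w => [|i ts IH] [|a w] //=; rewrite IH iterB. Qed.

Lemma monoC ts w i x : c i (mono ts w x) = mono ts w (c i x).
Proof. by elim: ts w => [|j ts IH] [|a w] //=; rewrite iterC IH. Qed.

Lemma mono_incr ts w k x : size w = size ts -> (k < size ts)%N ->
  mono ts (incr_nth w k) x = mono ts w (c (nth i0 ts k) x).
Proof.
elim: ts w k => [|i ts IH] [|a w] [|k] //= [sw] kt; last by rewrite IH.
by rewrite iterC monoC.
Qed.

Lemma subgrp_dspan ts H : subgrp H -> subgrp (dspan ts H).
Proof.
move=> gH; elim: ts => [|i ts [h0 hB]] /=.
  by split=> // x y /= -> ->; rewrite subr0.
split; first by exists 0; [exact: gH.1|rewrite c0 !subr0].
move=> x y [l Hl hl] [m Hm hm]; exists (l - m); first exact: gH.2.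
rewrite cB (_ : _ - _ = (x - (c i l - l)) - (y - (c i m - m))); last abel.
exact: hB.
Qed.

Lemma dspanS ts H H' : H `<=` H' -> dspan ts H `<=` dspan ts H'.
Proof.
move=> sH; elim: ts => [|i ts IH] //= x [l /sH Hl hl].
by exists l => //; exact: IH.
Qed.

Lemma mem_dspan ts H i l : subgrp H -> i \in ts -> H l -> dspan ts H (c i l - l).
Proof.
move=> gH; elim: ts => //= j ts IH; rewrite inE => /orP[/eqP ->|its] Hl.
  by exists l => //; rewrite subrr; exact: (subgrp_dspan ts gH).1.
by exists 0; [exact: gH.1|rewrite c0 !subr0; exact: IH].
Qed.

Lemma L_sub n : L n.+1 `<=` L n.
Proof. by move=> x /LS[]. Qed.

Lemma L_le m n : (m <= n)%N -> L n `<=` L m.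
Proof.
move=> /subnK <-; elim: (n - m)%N => // k IH.
by rewrite addSn; apply: subset_trans IH; exact: L_sub.
Qed.

Lemma L_mono ts w n x : {subset ts <= hs} -> L (sumn w + n)%N x -> L n (mono ts w x).
Proof.
elim: ts w n x => [|i ts IH] [|a w] n x sts /=.
- by [].
- by apply: L_le; exact: leq_addl.
- by [].
move=> hx; have {IH hx} : L (a + n)%N (mono ts w x).
  by apply: IH; [move=> j jt; apply: sts; rewrite inE jt orbT|rewrite addnCA addnA].
elim: a (mono ts w x) => [//|a IHa] y; rewrite addSn iterSr => /LS[_ hy].
by apply: IHa; apply: hy; apply: sts; rewrite inE eqxx.
Qed.

Lemma mono_nseq0 ts x : mono ts (nseq (size ts) 0%N) x = x.
Proof. by elim: ts => //= i ts ->. Qed.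

(** By [LS], going one level down is tested by applying the operators. Thus the classes modulo [L 1]
    of the monomials of degree [n] act as coefficients of [x] and detect [L n.+1] inside [L n]. *)
Lemma L_joint n x : L n x ->
  (forall w, size w = size hs -> sumn w = n -> L 1 (mono hs w x)) -> L n.+1 x.
Proof.
elim: n x => [|n IH] x Lx hw.
  by rewrite -(mono_nseq0 hs x); apply: hw; rewrite ?size_nseq // sumn_nseq.
apply/LS; split=> // i ih; apply: IH => [|w sw nw]; first exact: ((LS _ _).1 Lx).2.
have kh : (index i hs < size hs)%N by rewrite index_mem.
rewrite -[i](nth_index i0 ih) -mono_incr //; apply: hw.
  by rewrite size_incr_nth_lt // sw.
by rewrite sumn_incr ?nw // sw.
Qed.

(* The leading coefficients, modulo [L 1], of the members of [L (sumn w)] whose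
   lexicographically first nonzero coefficient is at the monomial [w]. *)
Definition lead w : set M := [set v | exists2 x, L (sumn w) x /\
    (forall w', size w' = size w -> sumn w' = sumn w -> lexlt w' w -> L 1 (mono hs w' x)) &
    L 1 (v - mono hs w x)].

(** The operator of index [k] turns the coefficient at [incr_nth w k] into the one at [w], and
    incrementing respects the lexicographic order. *)
Lemma lead_incr w k : size w = size hs -> (k < size hs)%N -> lead (incr_nth w k) `<=` lead w.
Proof.
move=> sw kh v [x [Lx hx] hv]; have kw : (k < size w)%N by rewrite sw.
rewrite sumn_incr // in Lx.
exists (c (nth i0 hs k) x); last by rewrite -mono_incr.
split; first by apply: ((LS _ _).1 Lx).2; exact: mem_nth.
move=> w' sw' nw' lw'; rewrite -mono_incr ?sw' //; apply: hx.
- by rewrite !size_incr_nth_lt // sw'.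
- by rewrite !sumn_incr ?nw' // sw'.
- by apply: lexlt_incr; rewrite // sw'.
Qed.

Lemma lead_lt u w : size u = size hs -> size w = size hs ->
  (forall k, (k < size hs)%N -> (nth 0 u k <= nth 0 w k)%N) -> u != w ->
  exists2 k, (k < size hs)%N & lead w `<=` lead (incr_nth u k).
Proof.
move: {2}(sumn w - sumn u)%N (leqnn (sumn w - sumn u)) => n.
elim: n u => [|n IH] u hn su sw hle uw.
all: have [|k ku hk] := exists_incr_le (etrans su (esym sw)) _ uw; first by rewrite su.
all: have sk := size_incr_nth_lt ku.
all: have := @sumn_le (incr_nth u k) w; rewrite sk su sw sumn_incr // => /(_ erefl).
all: rewrite su in ku hk; move=> /(_ hk) le_uw.
  by lia.
exists k => //; have [->//|kw] := eqVneq (incr_nth u k) w.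
have [||l ll hl] := IH (incr_nth u k) _ _ sw hk kw; rewrite ?sk //.
  by rewrite sumn_incr ?su //; lia.
by apply: subset_trans hl _; apply: lead_incr; rewrite ?sk.
Qed.

(** As [lead w] is a union of cosets of [L 1] inside [L 0], counting representatives measures its
    size. *)
Definition lead_count w := count (fun r => `[<lead w r>]) reps.

Lemma lead_count_le u w : lead w `<=` lead u -> (lead_count w <= lead_count u)%N.
Proof. by move=> h; apply: sub_count => r /asboolP /h ?; apply/asboolP. Qed.

Lemma lead_count_lt u w : lead w `<=` lead u -> ~ (lead u `<=` lead w) ->
  (lead_count w < lead_count u)%N.
Proof.
move=> wu /existsNP[v /not_implyP[[x [Lx hx] vx] nwv]].
have Lv : L 0 v.
  rewrite -(subrK (mono hs u x) v); apply: subgrpD; [exact: gL|exact: L_sub|].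
  by apply: L_mono => //; rewrite addn0.
have [r rr vr] := repsP Lv.
apply: (@count_lt _ _ _ _ r) => //.
- by move=> y /asboolP /wu ?; apply/asboolP.
- apply/asboolP; exists x => //.
  rewrite (_ : _ - _ = (v - mono hs u x) - (v - r)); last abel.
  exact: (gL 1).2.
- apply/asboolP => -[y hy ry]; apply: nwv; exists y => //.
  rewrite (_ : _ - _ = (v - r) + (r - mono hs w y)); last abel.
  exact: subgrpD.
Qed.

(** Otherwise there are exponents of unbounded degree at which [lead] drops strictly in every
    direction. Dickson's lemma gives two of them, [u] below [w], with
    [lead_count u <= lead_count w]; but [lead w] lies in some [lead (incr_nth u k)], which is
    strictly smaller than [lead u]. *)
Lemma lead_stable : exists n0, forall w, size w = size hs -> (n0 <= sumn w)%N ->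
  exists2 k, (k < size hs)%N & lead w `<=` lead (incr_nth w k).
Proof.
apply: contrapT => nostab.
have bad n : exists w, [/\ size w = size hs, (n <= sumn w)%N &
    forall k, (k < size hs)%N -> ~ (lead w `<=` lead (incr_nth w k))].
  apply: contrapT => hn; apply: nostab; exists n => w sw nw.
  apply: contrapT => hk; apply: hn; exists w; split=> // k kh hw.
  by apply: hk; exists k.
have [f hf] := choice bad.
(* The count is treated as one more coordinate, of index [size hs]. *)
pose fs i n := if (i < size hs)%N then nth 0%N (f n) i else lead_count (f n).
have [g hg hfs] := dickson fs (size hs).+1.
(* The index [(sumn u).+1] forces the degree of [w] above that of [u], so the two differ. *)
pose u := f (g 0%N); pose w := f (g (sumn u).+1).
have [su _ nu] := hf (g 0%N); have [sw nw _] := hf (g (sumn u).+1).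
have gn n : (n <= g n)%N by elim: n => // n IH; exact: leq_ltn_trans (hg n).
have uw : u != w.
  by apply/eqP => uw; have := leq_trans (gn _) nw; rewrite -/w -uw ltnn.
have [k kh hk] : exists2 k, (k < size hs)%N & lead w `<=` lead (incr_nth u k).
  apply: lead_lt => // k kh.
  by have := hfs k (ltnW kh) 0%N (sumn u).+1 isT; rewrite /fs kh.
have := hfs (size hs) (ltnSn _) 0%N (sumn u).+1 isT; rewrite /fs ltnn -/u -/w.
apply/negP; rewrite -ltnNge; apply: leq_ltn_trans (lead_count_le hk) _.
by apply: lead_count_lt; [exact: lead_incr|exact: nu].
Qed.

(** The coefficients of [x] in degree [n] are cleared one after the other in lexicographic order, by
    subtracting elements [c k z] with [z] in [L n.+1]; then [L_joint] applies. *)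
Theorem filtration_stable : exists n0, forall n, (n0 <= n)%N ->
  L n `<=` sumset (dspan hs (L n.+1)) (L n.+1).
Proof.
have [n0 hn0] := lead_stable; exists n0 => n nn x Lx.
set B := sumset _ _; have gD := subgrp_dspan hs (gL n.+1).
have gB : subgrp B.
  apply: (@subgrp_sumset _ _ [set 0]) => //; first by move=> _ ->; exact: gD.1.
    exact: (gL _).1.
  by move=> y z Ly Lz; exists 0 => //; rewrite subr0; exact: (gL _).2.
have BL : L n.+1 `<=` B by move=> y Ly; exact: sumset_memr.
(* An image [c k z] is the sum of [c k z - z] and [z]. *)
have Bc k z : (k < size hs)%N -> L n.+1 z -> B (c (nth i0 hs k) z).
  move=> kh Lz; rewrite -(subrK z (c _ z)); exists (c (nth i0 hs k) z - z).
    by apply: mem_dspan => //; exact: mem_nth.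
  by rewrite (_ : _ - _ = z) //; abel.
pose ws := sort lexle [seq w <- exponents (size hs) n | (size w == size hs) && (sumn w == n)].
have wsP w : (w \in ws) = (size w == size hs) && (sumn w == n).
  rewrite mem_sort mem_filter andb_idr // => /andP[/eqP <- /eqP <-].
  exact: mem_exponents.
suff [b Bb [Lxb hb]] : exists2 b, B b & L n (x - b) /\
    forall w, w \in ws -> L 1 (mono hs w (x - b)).
  rewrite -(subrK b x); apply: subgrpD => //; apply: BL.
  by apply: L_joint => // w sw nw; apply: hb; rewrite wsP sw nw !eqxx.
have sorted_ws : sorted lexle ws by exact: sort_sorted lexle_total _.
rewrite -[ws]cats0; move: [::] (cats0 ws) => l2 E.
suff : forall l1 l2, l1 ++ l2 = ws -> exists2 b, B b & L n (x - b) /\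
    forall w, w \in l1 -> L 1 (mono hs w (x - b)).
  by move=> h; rewrite E; exact: (h ws [::] (cats0 _)).
elim/last_ind=> [|l1 w IH] {E}l2 E.
  by exists 0; [exact: gB.1|rewrite subr0].
have [|b Bb [Lxb hb]] := IH (w :: l2); first by rewrite -cat_rcons.
have wws : w \in ws by rewrite -E mem_cat mem_rcons inE eqxx.
have /andP[/eqP sw /eqP nw] : (size w == size hs) && (sumn w == n) by rewrite -wsP.
have [k kh hk] := hn0 w sw (leq_trans nn (eq_leq (esym nw))).
have [l1w wl2] : all (lexle^~ w) l1 /\ all (lexle w) l2.
  move: sorted_ws; rewrite (sorted_pairwise lexle_trans) -E cat_rcons pairwise_cat /=.
  by rewrite allrel_consr => /and4P[/andP[-> _] _ -> _].
have before w' : size w' = size hs -> sumn w' = n -> lexlt w' w -> w' \in l1.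
  move=> sw' nw' lt; have : w' \in ws by rewrite wsP sw' nw' !eqxx.
  rewrite -E cat_rcons mem_cat inE => /or3P[//|/eqP ww|w'l2].
    by rewrite ww lexltxx in lt.
  have /orP[/eqP ww|ww] := allP wl2 _ w'l2; first by rewrite ww lexltxx in lt.
  by have := lexlt_trans lt ww; rewrite lexltxx.
(* The coefficient of [x - b] at [w] is a leading one because the smaller monomials are already
   cleared. By stability it is also that of some [z] in [L n.+1] at [incr_nth w k], so [c k z] has
   it at [w]. *)
have [z [Lz hz] wz] : lead (incr_nth w k) (mono hs w (x - b)).
  apply: hk; exists (x - b); last by rewrite subrr; exact: (gL _).1.
  rewrite nw sw; split=> // w' sw' nw' lt; apply: hb; exact: before.
have kw : (k < size w)%N by rewrite sw.
rewrite sumn_incr // nw in Lz.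
set y := c (nth i0 hs k) z.
have Ly : L n y by apply: ((LS _ _).1 Lz).2; exact: mem_nth.
exists (b + y); first by apply: subgrpD => //; exact: Bc.
have -> : x - (b + y) = (x - b) - y by abel.
split; first exact: (gL _).2.
move=> w'; have [-> _|ww'] := eqVneq w' w; first by rewrite monoB -mono_incr.
rewrite mem_rcons inE (negbTE ww') /= => w'l1.
(* Cleared coefficients stay cleared: those of [y] at the monomials smaller than [w] lie in
   [L 1]. *)
have : w' \in ws by rewrite -E cat_rcons mem_cat w'l1.
rewrite wsP => /andP[/eqP sw' /eqP nw'].
rewrite monoB -mono_incr //; apply: (gL _).2; first exact: hb.
apply: hz.
- by rewrite !size_incr_nth_lt ?sw' ?sw.
- by rewrite !sumn_incr ?nw' ?nw ?sw' ?sw.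
- apply: lexlt_incr; rewrite ?sw' ?sw //.
  by have := allP l1w _ w'l1; rewrite /lexle (negbTE ww').
Qed.
End DescendingFiltration.

(** * Topological groups: compactness, closures and normal subgroups *)

Section TopologicalGroups.
Variables (T : topologicalType) (G : topGroup T).
Local Notation "x ** y" := (tg_mul G x y) (at level 40, left associativity).
Local Notation "x ^-1" := (tg_inv G x).
Local Notation one := (tg_one G).
Implicit Types (x y z g : T) (A B C H K N O : set T).

Lemma tgA x y z : (x ** y) ** z = x ** (y ** z).
Proof. by rewrite tg_mulA. Qed.
Lemma tgKV x y : x ** (x^-1 ** y) = y.
Proof. by rewrite -tgA tg_mulgV tg_mul1g. Qed.
Lemma tgK x y : x^-1 ** (x ** y) = y.
Proof. by rewrite -tgA tg_mulVg tg_mul1g. Qed.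
Lemma tgI g x y : g ** x = g ** y -> x = y.
Proof. by move=> h; rewrite -(tgK g x) h tgK. Qed.
Lemma tg_invK x : (x^-1)^-1 = x.
Proof. by apply: (@tgI (x^-1)); rewrite tg_mulgV tg_mulVg. Qed.
Lemma tg_invM x y : (x ** y)^-1 = y^-1 ** x^-1.
Proof. by apply: (@tgI (x ** y)); rewrite tg_mulgV tgA tgKV tg_mulgV. Qed.
Lemma tg_inv1 : one^-1 = one.
Proof. by apply: (@tgI one); rewrite tg_mulgV tg_mul1g. Qed.

Definition tgE := (tgA, tg_mul1g, tg_mulg1, tg_mulVg, tg_mulgV, tgKV, tgK,
  tg_invK, tg_invM, tg_inv1).

Definition tg_conj g x := g ** x ** g^-1.

Lemma conjM g x y : tg_conj g (x ** y) = tg_conj g x ** tg_conj g y.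
Proof. by rewrite /tg_conj !tgE. Qed.
Lemma conjV g x : tg_conj g (x^-1) = (tg_conj g x)^-1.
Proof. by rewrite /tg_conj !tgE. Qed.
Lemma conj1 g : tg_conj g one = one.
Proof. by rewrite /tg_conj !tgE. Qed.
Lemma conj_conj g h x : tg_conj g (tg_conj h x) = tg_conj (g ** h) x.
Proof. by rewrite /tg_conj !tgE. Qed.
Lemma conj_one x : tg_conj one x = x.
Proof. by rewrite /tg_conj !tgE. Qed.

Section Continuity.
Variables (X : topologicalType) (f h : X -> T).
Hypotheses (cf : continuous f) (ch : continuous h).

Lemma continuousM : continuous (fun p => f p ** h p).
Proof.
move=> p O /(@tg_mul_cont _ G (f p, h p)) [[U V] /= [/cf nU /ch nV] h'].
have : nbhs p (f @^-1` U `&` h @^-1` V) by exact: filterI.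
by apply: filterS => q [Uq Vq]; exact: (h' (f q, h q)).
Qed.

Lemma continuousV : continuous (fun p => (f p)^-1).
Proof. by move=> p O /(@tg_inv_cont _ G (f p)) /cf. Qed.
End Continuity.

Lemma continuous_conj (X : topologicalType) (f h : X -> T) :
  continuous f -> continuous h -> continuous (fun p => tg_conj (f p) (h p)).
Proof.
move=> cf ch; apply: continuousM; first exact: continuousM.
exact: continuousV.
Qed.

Lemma continuous_cst (X Y : topologicalType) (y : Y) : continuous (fun _ : X => y).
Proof. by move=> x O nO; apply: (@filterE _ (nbhs x)) => z; exact: (@nbhs_singleton _ y). Qed.
Lemma continuous_id (X : topologicalType) : continuous (fun x : X => x).
Proof. by move=> x O. Qed.
Lemma continuous_fst (X Y : topologicalType) : continuous (fun p : X * Y => p.1).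
Proof. by move=> x; exact: cvg_fst. Qed.
Lemma continuous_snd (X Y : topologicalType) : continuous (fun p : X * Y => p.2).
Proof. by move=> x; exact: cvg_snd. Qed.

Lemma compact_image (X Y : topologicalType) (f : X -> Y) (K : set X) :
  continuous f -> compact K -> compact (f @` K).
Proof. by move=> cf; apply: continuous_compact; exact: continuous_subspaceT. Qed.

Lemma compact_image2 (X Y Z : topologicalType) (f : X * Y -> Z) (A : set X) (B : set Y) :
  continuous f -> compact A -> compact B ->
  compact [set z | exists a b, [/\ A a, B b & z = f (a, b)]].
Proof.
move=> cf cA cB; rewrite (_ : [set _ | _] = f @` (A `*` B)).
  by apply: compact_image => //; exact: compact_setX.
rewrite eqEsubset; split=> [z [a [b [Aa Bb ->]]]|_ [[a b] [Aa Bb] <-]].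
  by exists (a, b).
by exists a, b.
Qed.

Definition mulset A B : set T := [set z | exists a b, [/\ A a, B b & z = a ** b]].

Lemma compact_mulset A B : compact A -> compact B -> compact (mulset A B).
Proof. by move=> cA cB; exact: (compact_image2 (@tg_mul_cont _ G)). Qed.

(** The near-covering form of compactness is applied to the filter of finite lists of indices
    ordered by inclusion. *)
Lemma compact_seq_cover (I : eqType) (R : set I) (Q : I -> set T) K :
  compact K -> (forall x, K x -> exists2 i, R i & nbhs x (Q i)) ->
  exists s : seq I, (forall i, i \in s -> R i) /\
    forall x, K x -> exists2 i, i \in s & Q i x.
Proof.
move=> /compact_near_coveringP cK hK.
pose D := [set s : seq I | forall i, i \in s -> R i].
pose up (s : seq I) := D `&` [set s' | {subset s <= s'}].
have FF : Filter (filter_from D up).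
  apply: filter_from_filter; first by exists [::].
  move=> s s' Ds Ds'; exists (s ++ s').
    by move=> i; rewrite mem_cat => /orP[/Ds|/Ds'].
  move=> u [Du su]; split; split=> // i iu; apply: su; rewrite mem_cat iu ?orbT //.
have [x /hK[i Ri nQ]|s Ds hs] :=
    cK _ (filter_from D up) (fun s x => exists2 i, i \in s & Q i x) FF.
  exists (Q i, up [:: i]) => [|[y s] [/= Qy [_ si]]]; last first.
    by exists i => //; apply: si; rewrite inE.
  by split=> //; exists [:: i] => // j; rewrite inE => /eqP ->.
by exists s; split=> // x; apply: hs; split.
Qed.

Lemma nbhs_mull g x O : nbhs (g ** x) O -> nbhs x [set y | O (g ** y)].
Proof. by move: x O; apply: continuousM; [exact: continuous_cst|exact: continuous_id]. Qed.

Lemma nbhs_translate x O : nbhs one O -> nbhs x [set y | O (x^-1 ** y)].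
Proof. by move=> nO; apply: nbhs_mull; rewrite tg_mulVg. Qed.

Lemma nbhs_translate_inv x O : nbhs one O -> nbhs x [set y | O (y^-1 ** x)].
Proof.
move=> nO; have : continuous (fun y => y^-1 ** x).
  by apply: continuousM; [exact: tg_inv_cont|exact: continuous_cst].
by move=> /(_ x O); apply; rewrite tg_mulVg.
Qed.

Lemma nbhs_split O : nbhs one O ->
  exists2 U, nbhs one U & forall x y, U x -> U y -> O (x ** y^-1).
Proof.
move=> nO; have : continuous (fun p : T * T => p.1 ** p.2^-1).
  apply: continuousM; first exact: continuous_fst.
  by apply: continuousV; exact: continuous_snd.
move=> /(_ (one, one) O); rewrite /= tg_inv1 tg_mul1g => /(_ nO)[[U V] /= [nU nV] h].
exists (U `&` V); first exact: filterI.
by move=> x y [Ux _] [_ Vy]; exact: (h (x, y)).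
Qed.

Lemma closure_translate A x O : closure A x -> nbhs one O ->
  exists2 a, A a & O (a^-1 ** x).
Proof.
move=> clA nO; have [a [Aa Oa]] := clA _ (nbhs_translate_inv x nO).
by exists a.
Qed.

Lemma compact_finite_translates K O : compact K -> nbhs one O ->
  exists s : seq T, (forall y, y \in s -> K y) /\
    forall x, K x -> exists2 y, y \in s & O (y^-1 ** x).
Proof.
move=> cK nO; apply: (@compact_seq_cover _ K (fun y => [set x | O (y^-1 ** x)])) => //.
by move=> x Kx; exists x => //; exact: nbhs_translate.
Qed.

(** The tube lemma, with compact parameter set [K]. *)
Lemma compact_tube (X Y : topologicalType) (f : T * X -> Y) g (K : set X) (O : set Y) :
  continuous f -> compact K -> (forall k, K k -> nbhs (f (g, k)) O) ->
  nbhs g [set g' | forall k, K k -> O (f (g', k))].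
Proof.
move=> cf /compact_near_coveringP cK hO.
apply: (cK T (nbhs g) (fun g' k => O (f (g', k)))) => x /hO /cf [[U V] /= [nU nV] h].
by exists (V, U) => // -[k g'] [/= Vk Ug]; exact: (h (g', k)).
Qed.

Lemma closure_image (X Y : topologicalType) (f : X -> Y) (A : set X) (B : set Y) (x : X) :
  continuous f -> (forall a, A a -> B (f a)) -> closure A x -> closure B (f x).
Proof.
move=> cf AB clA O /cf nO; have [a [Aa Oa]] := clA _ nO.
by exists (f a); split=> //; exact: AB.
Qed.

Lemma closure_image2 (X Y Z : topologicalType) (f : X * Y -> Z)
    (A : set X) (B : set Y) (C : set Z) (x : X) (y : Y) :
  continuous f -> (forall a b, A a -> B b -> C (f (a, b))) ->
  closure A x -> closure B y -> closure C (f (x, y)).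
Proof.
move=> cf AB clA clB O /cf [[U V] /= [nU nV] h].
have [a [Aa Ua]] := clA _ nU; have [b [Bb Vb]] := clB _ nV.
by exists (f (a, b)); split; [exact: AB|exact: (h (a, b))].
Qed.

(** For [x] outside the product, the tube lemma keeps [k^-1 ** y] outside [A] for all [k] in [K] and
    all [y] near [x]. *)
Lemma closed_mulset K A : compact K -> closed A -> closed (mulset K A).
Proof.
move=> cK clA x clx; apply: contrapT => nx.
have : nbhs x [set y | forall k, K k -> (~` A) (k^-1 ** y)].
  apply: (@compact_tube _ _ (fun p => p.2^-1 ** p.1)) => //.
    by apply: continuousM; [apply: continuousV; exact: continuous_snd|exact: continuous_fst].
  move=> k Kk; apply: open_nbhs_nbhs; split; first exact: closed_openC.
  by move=> Akx; apply: nx; exists k, (k^-1 ** x); rewrite tgKV.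
move=> /clx[z [[k [a [Kk Aa ->]]]]] /(_ k Kk); rewrite tgK; exact.
Qed.

Lemma subgroup1 H : is_subgroup G H -> H one. Proof. by case. Qed.
Lemma subgroupM H x y : is_subgroup G H -> H x -> H y -> H (x ** y).
Proof. by case=> _ [hM _]; exact: hM. Qed.
Lemma subgroupV H x : is_subgroup G H -> H x -> H (x^-1).
Proof. by case=> _ [_ hV]; exact: hV. Qed.

Lemma normal_subgroup N : is_normal_subgroup G N -> is_subgroup G N.
Proof. by case. Qed.
Lemma normal_conj N g x : is_normal_subgroup G N -> N x -> N (tg_conj g x).
Proof. by case=> _; exact. Qed.

Lemma subgroup_closure H : is_subgroup G H -> is_subgroup G (closure H).
Proof.
move=> gH; split; first by apply: subset_closure; exact: subgroup1.
split=> [x y|x].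
  by apply: (closure_image2 (@tg_mul_cont _ G)) => a b; exact: subgroupM.
by apply: closure_image; [exact: tg_inv_cont|move=> a; exact: subgroupV].
Qed.

Lemma normal_closure N : is_normal_subgroup G N -> is_normal_subgroup G (closure N).
Proof.
move=> nN; split; first by apply: subgroup_closure; exact: normal_subgroup.
move=> g x; apply: (@closure_image _ _ (tg_conj g)) => [|a]; last exact: normal_conj.
by apply: continuous_conj; [exact: continuous_cst|exact: continuous_id].
Qed.

Lemma normalI N N' : is_normal_subgroup G N -> is_normal_subgroup G N' ->
  is_normal_subgroup G (N `&` N').
Proof.
move=> [[n1 [nM nV]] nJ] [[n1' [nM' nV']] nJ']; split; last first.
  by move=> g x [? ?]; split; [exact: nJ|exact: nJ'].
split=> //; split=> [x y [? ?] [? ?]|x [? ?]]; first by split; [exact: nM|exact: nM'].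
by split; [exact: nV|exact: nV'].
Qed.

Lemma normal_mulset N N' : is_normal_subgroup G N -> is_normal_subgroup G N' ->
  is_normal_subgroup G (mulset N N').
Proof.
move=> nN nN'; have gN := normal_subgroup nN; have gN' := normal_subgroup nN'.
split; last first.
  move=> g _ [a [b [Na Nb ->]]]; exists (tg_conj g a), (tg_conj g b).
  by split; [exact: normal_conj|exact: normal_conj|rewrite -conjM].
split; first by exists one, one; split; rewrite ?tg_mul1g //; exact: subgroup1.
split=> [_ _ [a [b [Na Nb ->]]] [a' [b' [Na' Nb' ->]]]|_ [a [b [Na Nb ->]]]].
  exists (a ** tg_conj b a'), (b ** b'); split; last by rewrite /tg_conj !tgE.
    by apply: subgroupM => //; exact: normal_conj.
  exact: subgroupM.
exists (tg_conj (b^-1) (a^-1)), (b^-1); split; last by rewrite /tg_conj !tgE.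
  by apply: normal_conj => //; exact: subgroupV.
exact: subgroupV.
Qed.

Lemma subgroup_setT : is_subgroup G [set: T]. Proof. by split. Qed.
Lemma normal_one : is_normal_subgroup G [set one].
Proof.
split; last by move=> g _ ->; rewrite !tgE.
by split=> //; split=> [x y -> ->|x ->]; rewrite !tgE.
Qed.

Lemma gen_subgroupP A : is_subgroup G (gen_subgroup G A).
Proof.
split; first by move=> H [].
split=> [x y hx hy H gH AH|x hx H gH AH].
  by apply: subgroupM => //; [exact: hx|exact: hy].
by apply: subgroupV => //; exact: hx.
Qed.

Lemma sub_gen_subgroup A : A `<=` gen_subgroup G A.
Proof. by move=> x Ax H _; exact. Qed.

Lemma conj_commg g x y : tg_conj g (Defs.commg G x y) = Defs.commg G (tg_conj g x) (tg_conj g y).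
Proof. by rewrite /Defs.commg !conjM !conjV. Qed.

Lemma continuous_commg : continuous (fun p : T * T => Defs.commg G p.1 p.2).
Proof.
have f1 := @continuous_fst T T; have f2 := @continuous_snd T T.
by repeat first [exact: f1 | exact: f2 | apply: continuousM | apply: continuousV].
Qed.

Lemma mem_derived x y : derived G (Defs.commg G x y).
Proof. by apply: sub_gen_subgroup; exists x, y. Qed.

Lemma subgroup_derived : is_subgroup G (derived G).
Proof. exact: gen_subgroupP. Qed.

Lemma normal_derived : is_normal_subgroup G (derived G).
Proof.
split; first exact: subgroup_derived.
move=> g x hx; apply: (hx [set x | derived G (tg_conj g x)]); last first.
  by move=> _ [a [b ->]] /=; rewrite conj_commg; exact: mem_derived.
have gD := subgroup_derived.
split; first by rewrite /= conj1; exact: subgroup1.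
split=> [a b|a] /=; first by rewrite conjM; exact: subgroupM.
by rewrite conjV; exact: subgroupV.
Qed.

Lemma swap_commg x y : x ** y = y ** x ** Defs.commg G x y.
Proof. by rewrite /Defs.commg !tgE. Qed.

(** The elements that conjugate [H] into itself together with their inverses form a subgroup
    containing [S]. *)
Lemma normal_gen S H : gen_subgroup G S = [set: T] -> (forall s, S s -> S (s^-1)) ->
  is_subgroup G H -> (forall s x, S s -> H x -> H (tg_conj s x)) -> is_normal_subgroup G H.
Proof.
move=> genS symS gH hS; split=> // g x Hx.
have : gen_subgroup G S g by rewrite genS.
move/(_ [set g | (forall x, H x -> H (tg_conj g x)) /\ (forall x, H x -> H (tg_conj (g^-1) x))]).
case=> //; [|by move=> s Ss; split=> y; apply: hS => //; exact: symS|by move=> h _; exact: h].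
split; first by split=> y; rewrite ?tg_inv1 conj_one.
split=> [a b [h1 h2] [h3 h4]|a [h1 h2]]; last by split=> // y; rewrite tg_invK; exact: h1.
split=> y Hy; rewrite ?tg_invM -conj_conj; [exact/h1/h3|exact/h4/h2].
Qed.

(** For fixed [x], the elements whose commutator with [x] lies in [N] form a subgroup, as [N] is
    normal; this is used in each argument in turn. *)
Lemma derived_sub_gen S N : gen_subgroup G S = [set: T] -> is_normal_subgroup G N ->
  (forall s t, S s -> S t -> N (Defs.commg G s t)) -> derived G `<=` N.
Proof.
move=> genS nN hS; have gN := normal_subgroup nN.
have commM x y z : N (Defs.commg G x y) -> N (Defs.commg G x z) -> N (Defs.commg G x (y ** z)).
  move=> hy hz; rewrite (_ : Defs.commg _ _ _ = Defs.commg G x z ** tg_conj (z^-1) (Defs.commg G x y)).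
    by apply: subgroupM => //; exact: normal_conj.
  by rewrite /Defs.commg /tg_conj !tgE.
have comm1 x : N (Defs.commg G x one).
  rewrite (_ : Defs.commg _ _ _ = one); first exact: subgroup1.
  by rewrite /Defs.commg !tgE.
have commV x y : N (Defs.commg G x y) -> N (Defs.commg G x (y^-1)).
  move=> hy; rewrite (_ : Defs.commg _ _ _ = tg_conj y ((Defs.commg G x y)^-1)).
    by apply: normal_conj => //; exact: subgroupV.
  by rewrite /Defs.commg /tg_conj !tgE.
have commC x y : N (Defs.commg G x y) -> N (Defs.commg G y x).
  move=> hy; rewrite (_ : Defs.commg G y x = (Defs.commg G x y)^-1); first exact: subgroupV.
  by rewrite /Defs.commg !tgE.
have comm_all x : (forall s, S s -> N (Defs.commg G x s)) -> forall y, N (Defs.commg G x y).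
  move=> hx y; have : gen_subgroup G S y by rewrite genS.
  move/(_ [set y | N (Defs.commg G x y)]); apply=> [|s Ss]; last exact: hx.
  split; first exact: comm1.
  by split=> [a b|a]; [exact: commM|exact: commV].
move=> z; apply=> // _ [x [y ->]]; apply: (comm_all) => s Ss; apply: commC.
by apply: comm_all => t St; exact: hS.
Qed.
(** Commutators are trivial on the dense part, and [[set one]] is closed because the space is
    Hausdorff. *)
Lemma closure_derived_commute a b : hausdorff_space T -> metabelian G ->
  closure (derived G) a -> closure (derived G) b -> Defs.commg G a b = one.
Proof.
move=> hT metG Da Db.
have clone : closed [set one] by apply: compact_closed => //; exact: compact_set1.
suff : closure [set one] (Defs.commg G a b) by move/clone.
apply: (closure_image2 continuous_commg) Da Db => x y Dx Dy /=.
by rewrite /Defs.commg -tg_invM -(metG x y) // tgA tg_mulVg.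
Qed.
End TopologicalGroups.

(** * The algebraic quotient of [A] by [N] as an additive group *)

Section AbelianQuotient.
Variables (T : topologicalType) (G : topGroup T) (A N : set T).
Local Notation "x ** y" := (tg_mul G x y) (at level 40, left associativity).
Local Notation "x ^-1" := (tg_inv G x).
Local Notation one := (tg_one G).
Hypotheses (gA : is_subgroup G A) (gN : is_subgroup G N) (NA : N `<=` A).
Hypothesis commN : forall a b, A a -> A b -> N (Defs.commg G a b).

(** The choice depends on the coset only, so the quotient can be realised by the fixed points of
    [coset_repr]. The default is never reached, [x] itself being a candidate. *)
Definition coset_repr (x : T) : T := xget one [set y | N (x^-1 ** y)].

Lemma coset_reprP x : N (x^-1 ** coset_repr x).
Proof.
apply: (@xgetPex _ one [set y | N (x^-1 ** y)]).
by exists x; rewrite /= tg_mulVg; exact: subgroup1.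
Qed.

Lemma coset_repr_eq x y : N (x^-1 ** y) -> coset_repr x = coset_repr y.
Proof.
move=> xy; congr xget; apply/seteqP; split=> z /= hz.
  rewrite (_ : y^-1 ** z = (x^-1 ** y)^-1 ** (x^-1 ** z)); last by rewrite !tgE.
  by apply: subgroupM => //; exact: subgroupV.
rewrite (_ : x^-1 ** z = (x^-1 ** y) ** (y^-1 ** z)); last by rewrite !tgE.
exact: subgroupM.
Qed.

Lemma mem_coset_repr x : A x -> A (coset_repr x).
Proof.
move=> Ax; rewrite -(tgKV G x (coset_repr x)); apply: subgroupM => //.
exact/NA/coset_reprP.
Qed.

Lemma coset_repr_idem x : coset_repr (coset_repr x) = coset_repr x.
Proof. by apply/esym/coset_repr_eq; exact: coset_reprP. Qed.

Lemma coset_reprM x y : A x -> A y ->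
  coset_repr (coset_repr x ** coset_repr y) = coset_repr (x ** y).
Proof.
move=> Ax Ay; apply/esym/coset_repr_eq.
(* Conjugating [n] by [y] multiplies it by a commutator of elements of [A], which lies in [N]. *)
set n := x^-1 ** coset_repr x; have Nn : N n := coset_reprP x.
rewrite (_ : _ ** _ = n ** Defs.commg G n y ** (y^-1 ** coset_repr y)).
  apply: subgroupM (coset_reprP y) => //; apply: subgroupM => //.
  by apply: commN => //; exact: NA.
by rewrite /n /Defs.commg !tgE.
Qed.

Definition coset_type := {x : T | `[< A x /\ coset_repr x = x >]}.
HB.instance Definition _ := Choice.on coset_type.

Lemma coset_class_subproof x : A x ->
  `[< A (coset_repr x) /\ coset_repr (coset_repr x) = coset_repr x >].
Proof. by move=> Ax; apply/asboolP; split; [exact: mem_coset_repr|exact: coset_repr_idem]. Qed.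

Definition coset_class x : coset_type :=
  match pselect (A x) with
  | left Ax => exist _ (coset_repr x) (coset_class_subproof Ax)
  | right _ => exist _ (coset_repr one) (coset_class_subproof (subgroup1 gA))
  end.

Lemma coset_classE x : A x -> sval (coset_class x) = coset_repr x.
Proof. by rewrite /coset_class; case: pselect. Qed.

Lemma coset_typeP (u : coset_type) : A (sval u) /\ coset_repr (sval u) = sval u.
Proof. by case: u => x /= /asboolP. Qed.

Lemma coset_classK (u : coset_type) : coset_class (sval u) = u.
Proof.
by apply: val_inj; rewrite /= coset_classE; [exact: (coset_typeP u).2|exact: (coset_typeP u).1].
Qed.

Lemma coset_class_eq x y : A x -> A y -> coset_class x = coset_class y <-> N (x^-1 ** y).
Proof.
move=> Ax Ay; split=> [/(congr1 sval)|xy]; last first.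
  by apply: val_inj; rewrite /= !coset_classE //; exact: coset_repr_eq.
rewrite !coset_classE // => E.
rewrite (_ : _ ** _ = (x^-1 ** coset_repr x) ** (y^-1 ** coset_repr y)^-1).
  by apply: subgroupM => //; [|apply: subgroupV => //]; exact: coset_reprP.
by rewrite E !tgE.
Qed.

Let cadd (u v : coset_type) := coset_class (sval u ** sval v).
Let copp (u : coset_type) := coset_class ((sval u)^-1).

Let cosetM x y : A x -> A y -> cadd (coset_class x) (coset_class y) = coset_class (x ** y).
Proof.
move=> Ax Ay; apply: val_inj; rewrite /= /cadd !coset_classE ?coset_reprM //.
- exact: subgroupM.
- by apply: subgroupM => //; exact: mem_coset_repr.
Qed.

Let caddA : associative cadd.
Proof.
move=> u v w; rewrite -(coset_classK u) -(coset_classK v) -(coset_classK w).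
have [Au _] := coset_typeP u; have [Av _] := coset_typeP v; have [Aw _] := coset_typeP w.
by rewrite !cosetM ?tgA //; exact: subgroupM.
Qed.

Let caddC : commutative cadd.
Proof.
move=> u v; rewrite -(coset_classK u) -(coset_classK v).
have [Au _] := coset_typeP u; have [Av _] := coset_typeP v.
rewrite !cosetM //; apply/coset_class_eq; [exact: subgroupM|exact: subgroupM|].
rewrite (_ : _ ** _ = Defs.commg G (sval v) (sval u)); first exact: commN.
by rewrite /Defs.commg !tgE.
Qed.

Let cadd0 : left_id (coset_class one) cadd.
Proof.
move=> u; rewrite -(coset_classK u); have [Au _] := coset_typeP u.
by rewrite cosetM ?tg_mul1g //; exact: subgroup1.
Qed.

Let caddN : left_inverse (coset_class one) copp cadd.
Proof.
move=> u; have [Au _] := coset_typeP u.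
by rewrite /copp -{2}(coset_classK u) cosetM ?tg_mulVg //; exact: subgroupV.
Qed.

Let coset_zmod : zmodType :=
  HB.pack_for zmodType coset_type (GRing.isZmodule.Build coset_type caddA caddC cadd0 caddN).

Lemma abelian_quotient : exists (M : zmodType) (phi : T -> M), [/\
  forall x y, A x -> A y -> phi (x ** y) = phi x + phi y,
  forall u, exists2 x, A x & phi x = u &
  forall x y, A x -> A y -> (phi x = phi y <-> N (x^-1 ** y))].
Proof.
exists coset_zmod, coset_class; split; last exact: coset_class_eq.
  by move=> x y Ax Ay; rewrite -cosetM.
by move=> u; exists (sval u); [exact: (coset_typeP u).1|exact: coset_classK].
Qed.
End AbelianQuotient.

(** * Neighbourhoods and bounded sets in the quotient *)

Section QuotientNeighbourhoods.
Variables (T : topologicalType) (G : topGroup T) (A N : set T).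
Local Notation "x ** y" := (tg_mul G x y) (at level 40, left associativity).
Local Notation "x ^-1" := (tg_inv G x).
Local Notation one := (tg_one G).
Hypothesis gA : is_subgroup G A.
Variables (M : zmodType) (phi : T -> M).
Hypothesis phiM : forall x y, A x -> A y -> phi (x ** y) = phi x + phi y.
Hypothesis phi_surj : forall u, exists2 x, A x & phi x = u.
Hypothesis phi_eq : forall x y, A x -> A y -> (phi x = phi y <-> N (x^-1 ** y)).
Variable C0 : set T.
Hypotheses (cC0 : compact C0) (nC0 : nbhs one C0) (clA : closed A).

(** The neighbourhoods of 0 for the quotient topology, described without making [M] a topological
    space. *)
Definition quo_nb : set (set M) :=
  [set V | exists2 O, nbhs one O & forall a, A a -> O a -> V (phi a)].

Lemma phi1 : phi one = 0.
Proof.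
have A1 := subgroup1 gA; have := phiM A1 A1; rewrite tg_mul1g => /eqP.
by rewrite -subr_eq0 opprD addNKr oppr_eq0 => /eqP.
Qed.

Lemma phiV x : A x -> phi (x^-1) = - phi x.
Proof.
move=> Ax; have := phiM (subgroupV gA Ax) Ax.
by rewrite tg_mulVg phi1 => /esym /eqP; rewrite addr_eq0 => /eqP.
Qed.

Lemma phi_div x y : A x -> A y -> phi (x ** y^-1) = phi x - phi y.
Proof. by move=> Ax Ay; rewrite phiM ?phiV //; exact: subgroupV. Qed.

Lemma phi_ldiv x y : A x -> A y -> phi (y^-1 ** x) = phi x - phi y.
Proof. by move=> Ax Ay; rewrite phiM ?phiV 1?addrC //; exact: subgroupV. Qed.

Lemma quo_nb0 V : quo_nb V -> V 0.
Proof.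
move=> [Z nZ hZ]; rewrite -phi1; apply: hZ; first exact: subgroup1.
exact: nbhs_singleton.
Qed.

Lemma quo_nb_half V : quo_nb V ->
  exists2 V', quo_nb V' & forall x y, V' x -> V' y -> V (x - y).
Proof.
move=> [Z nZ hZ]; have [U nU hU] := nbhs_split nZ.
exists (phi @` (A `&` U)); first by exists U => // a Aa Ua; exists a.
move=> _ _ [a [Aa Ua] <-] [b [Ab Ub] <-]; rewrite -phi_div //; apply: hZ.
  by apply: subgroupM => //; exact: subgroupV.
exact: hU.
Qed.

Lemma bounded_image X : compact X -> X `<=` A -> bounded quo_nb (phi @` X).
Proof.
move=> cX XA V [Z nZ hZ]; have [s [sX hs]] := compact_finite_translates cX nZ.
exists (map phi s) => _ [x Xx <-]; have [y ys hy] := hs x Xx.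
exists (phi y); first exact: map_f.
have [Ax Ay] := (XA _ Xx, XA _ (sX _ ys)).
rewrite -phi_ldiv //; apply: hZ => //.
by apply: subgroupM => //; exact: subgroupV.
Qed.

Definition quo_ball : set M := phi @` (A `&` C0).

Lemma quo_nb_ball : quo_nb quo_ball.
Proof. by exists C0 => // a Aa Ca; exists a. Qed.

Lemma bounded_ball : bounded quo_nb quo_ball.
Proof.
apply: bounded_image => [|a []//].
by rewrite setIC; exact: compact_closedI.
Qed.

(** Finitely many translates of the image of [C0] cover [Y]; lifting their centres gives finitely
    many translates of [C0], whose union is compact. *)
Lemma bounded_preimage Y : bounded quo_nb Y ->
  exists2 K, compact K & forall a, A a -> Y (phi a) -> mulset G K N a.
Proof.
move=> bY; have [s hs] := bY _ quo_nb_ball.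
have /choice[r hr] : forall u, exists x, A x /\ phi x = u.
  by move=> u; have [x Ax xu] := phi_surj u; exists x.
exists (mulset G [set x | x \in map r s] C0).
  apply: compact_mulset => //; apply: finite_compact; exact: finite_seq.
move=> a Aa Ya; have [y ys [c [Ac Cc] hc]] := hs _ Ya; have [Ar ry] := hr y.
exists (r y ** c), ((r y ** c)^-1 ** a); split; last by rewrite tgKV.
  by exists (r y), c; split=> //; exact: map_f.
apply/phi_eq => //; first exact: subgroupM.
by rewrite phiM // ry hc addrC subrK.
Qed.

Lemma bounded_cover X : bounded quo_nb X -> exists E : seq M,
  X `<=` sumset (zspan E) quo_ball.
Proof.
move=> bX; have [s hs] := bX _ quo_nb_ball; exists s => x /hs[y ys hy].
by exists y => //; exact: mem_zspan.
Qed.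

Lemma quo_bounded_subgroups xs K : bounded quo_nb K -> exists2 K', bounded quo_nb K' &
  forall H, subgrp H -> bounded quo_nb H -> H `<=` sumset (zspan xs) K -> H `<=` K'.
Proof.
exact: (bounded_subgroups quo_nb0 quo_nb_half quo_nb_ball bounded_ball).
Qed.

Lemma subgrp_image H : is_subgroup G H -> H `<=` A -> subgrp (phi @` H).
Proof.
move=> gH HA; split; first by exists one; [exact: subgroup1|exact: phi1].
move=> _ _ [x Hx <-] [y Hy <-]; exists (x ** y^-1); last by rewrite phi_div //; exact: HA.
by apply: subgroupM => //; exact: subgroupV.
Qed.

Lemma subgroup_preimage H : subgrp H -> is_subgroup G [set a | A a /\ H (phi a)].
Proof.
move=> gH; split; first by split; [exact: subgroup1|rewrite phi1; exact: gH.1].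
split=> [x y [Ax Hx] [Ay Hy]|x [Ax Hx]].
  by split; [exact: subgroupM|rewrite phiM //; exact: subgrpD].
by split; [exact: subgroupV|rewrite phiV //; exact: subgrpN].
Qed.
End QuotientNeighbourhoods.

(** * Compact normal subgroups and the closedness of [W] *)

Section MaximalCompactNormal.
Variables (T : topologicalType) (G : topGroup T).
Local Notation "x ** y" := (tg_mul G x y) (at level 40, left associativity).
Local Notation "x ^-1" := (tg_inv G x).
Local Notation one := (tg_one G).
Local Notation W := (W G).

Definition compact_normal (P : set T) := compact P /\ is_normal_subgroup G P.

Lemma compact_normal_one : compact_normal [set one].
Proof. by split; [exact: compact_set1|exact: normal_one]. Qed.

Lemma compact_normalM P P' : compact_normal P -> compact_normal P' ->
  compact_normal (mulset G P P').
Proof.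
by move=> [cP nP] [cP' nP']; split; [exact: compact_mulset|exact: normal_mulset].
Qed.

Lemma sub_mulsetl P P' : is_subgroup G P' -> P `<=` mulset G P P'.
Proof. by move=> gP' x Px; exists x, one; rewrite tg_mulg1; split=> //; exact: subgroup1. Qed.

Lemma sub_mulsetr P P' : is_subgroup G P -> P' `<=` mulset G P P'.
Proof. by move=> gP x Px; exists one, x; rewrite tg_mul1g; split=> //; exact: subgroup1. Qed.

Lemma compact_normalI P A : closed A -> is_normal_subgroup G A -> compact_normal P ->
  compact_normal (P `&` A).
Proof.
by move=> clA nA [cP nP]; split; [exact: compact_closedI|exact: normalI].
Qed.

Lemma W_intro P : compact_normal P -> P `<=` W.
Proof. by move=> [cP nP] x Px; exists P. Qed.

Lemma W_elim x : W x -> exists2 P, compact_normal P & P x.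
Proof. by move=> [P [cP nP Px]]; exists P. Qed.

Lemma normal_W : is_normal_subgroup G W.
Proof.
split; last first.
  move=> g x /W_elim[P [cP nP] Px]; exists P; split=> //.
  exact: (@normal_conj _ G P g x).
split; first by apply: (W_intro compact_normal_one).
split=> [x y /W_elim[P hP Px] /W_elim[P' hP' Py]|x /W_elim[P hP Px]].
  by apply: (W_intro (compact_normalM hP hP')); exists x, y.
by apply: (W_intro hP); apply: subgroupV => //; exact: normal_subgroup hP.2.
Qed.

Lemma W_seq (s : seq T) : (forall x, x \in s -> W x) ->
  exists2 P, compact_normal P & forall x, x \in s -> P x.
Proof.
elim: s => [|a s IH] hs; first by exists [set one] => //; exact: compact_normal_one.
have [|P hP sP] := IH; first by move=> x xs; apply: hs; rewrite inE xs orbT.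
have [P' hP' aP'] := W_elim (hs a (mem_head _ _)).
exists (mulset G P' P); first exact: compact_normalM.
move=> x; rewrite inE => /orP[/eqP ->|/sP Px].
  by apply: sub_mulsetl => //; exact: normal_subgroup hP.2.
by apply: sub_mulsetr => //; exact: normal_subgroup hP'.2.
Qed.

Variables (C0 S : set T).
Hypotheses (cC0 : compact C0) (nC0 : nbhs one C0).
Hypotheses (cS : compact S) (genS : gen_subgroup G S = [set: T]).
Hypothesis symS : forall s, S s -> S (s^-1).

(* A compact neighbourhood [V] of the identity in the closure of [W] becomes a
   compact normal subgroup after multiplication by a large enough one. *)
Lemma W_open_part : exists2 P, compact_normal P &
  forall x, closure W x -> C0 x -> P x.
Proof.
set B := closure W; have nB : is_normal_subgroup G B := normal_closure normal_W.
have gB := normal_subgroup nB.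
pose V := C0 `&` B.
have cV : compact V by apply: compact_closedI => //; exact: closed_closure.
have V1 : V one by split; [exact: nbhs_singleton|exact: subgroup1].
(* [X] collects the products and inverses of elements of [V] and their conjugates by [S]. Being
   compact, it is covered by finitely many translates of [C0] centred in the dense part [W] of [B];
   one compact normal [P0] contains the centres, so [X] lies in [P0 V]. *)
pose X := mulset G V V `|` (tg_inv G @` V) `|`
  [set z | exists a b, [/\ S a, V b & z = tg_conj G (a, b).1 (a, b).2]].
have cX : compact X.
  apply: compactU; last first.
    apply: (compact_image2 (f := fun p : T * T => tg_conj G p.1 p.2)) => //.
    by apply: continuous_conj; [exact: continuous_fst|exact: continuous_snd].
  apply: compactU; first exact: compact_mulset.
  by apply: compact_image => //; exact: tg_inv_cont.
have XB : X `<=` B.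
  move=> z [[[a [b [[_ Ba] [_ Bb] ->]]]|[a [_ Ba] <-]]|[a [b [_ [_ Bb] ->]]]].
  - exact: (subgroupM gB).
  - exact: (subgroupV gB).
  - exact: (normal_conj _ nB).
have [x Xx|s [sW hs]] :=
    @compact_seq_cover _ _ W (fun u => [set x | C0 (u^-1 ** x)]) X cX.
  have nO : nbhs one (interior C0).
    by apply: open_nbhs_nbhs; split=> //; exact: open_interior.
  have [u Wu hu] := closure_translate (XB _ Xx) nO.
  by exists u => //; exact: nbhs_mull.
have [P0 hP0 sP0] := W_seq sW; have [cP0 nP0] := hP0.
have gP0 := normal_subgroup nP0.
have XP : X `<=` mulset G P0 V.
  move=> x Xx; have [u us hu] := hs x Xx.
  exists u, (u^-1 ** x); split; [exact: sP0| |by rewrite tgKV].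
  split=> //; apply: (subgroupM gB) (XB _ Xx); apply: (subgroupV gB).
  by apply: subset_closure; exact: sW.
have PV p v : P0 p -> mulset G P0 V v -> mulset G P0 V (p ** v).
  move=> Pp [p' [v' [Pp' Vv' ->]]]; exists (p ** p'), v'; split=> //.
    exact: subgroupM.
  by rewrite tgA.
have gP : is_subgroup G (mulset G P0 V).
  split; first by exists one, one; rewrite tg_mul1g; split=> //; exact: subgroup1.
  split=> [_ _ [p [v [Pp Vv ->]]] [p' [v' [Pp' Vv' ->]]]|_ [p [v [Pp Vv ->]]]].
    rewrite (_ : _ ** _ = (p ** tg_conj G v p') ** (v ** v')); last by rewrite /tg_conj !tgE.
    apply: PV; first by apply: subgroupM => //; exact: normal_conj.
    by apply: XP; left; left; exists v, v'.
  rewrite (_ : _^-1 = tg_conj G (v^-1) (p^-1) ** v^-1); last by rewrite /tg_conj !tgE.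
  apply: PV; first by apply: normal_conj => //; exact: subgroupV.
  by apply: XP; left; right; exists v.
exists (mulset G P0 V); last first.
  by move=> x Bx Cx; apply: sub_mulsetr.
split; first exact: compact_mulset.
apply: (normal_gen genS symS gP) => g _ Sg [p [v [Pp Vv ->]]].
rewrite conjM; apply: PV; first exact: normal_conj.
by apply: XP; right; exists g, v.
Qed.

(** A point of the closure is a translate, by an element of [W], of a point of the closure inside
    [C0], which [W_open_part] puts in [W]. *)
Lemma closed_W : closed W.
Proof.
have [P hP hW] := W_open_part; have gW := normal_subgroup normal_W.
move=> x clx; have [u Wu hu] := closure_translate clx nC0.
rewrite -(tgKV G u x); apply: subgroupM => //; apply: (W_intro hP); apply: hW => //.
apply: subgroupM clx; first exact: subgroup_closure.
by apply: subset_closure; exact: subgroupV.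
Qed.

Lemma compact_sub_W X : compact X -> X `<=` W ->
  exists2 P, compact_normal P & X `<=` P.
Proof.
move=> cX XW; have [P hP hW] := W_open_part; have gW := normal_subgroup normal_W.
have [s [sX hs]] := compact_finite_translates cX nC0.
have [P' hP' sP'] := W_seq (fun y ys => XW _ (sX y ys)).
exists (mulset G P' P); first exact: compact_normalM.
move=> x Xx; have [y ys hy] := hs x Xx.
exists y, (y^-1 ** x); split; [exact: sP'| |by rewrite tgKV].
apply: hW => //; apply: subset_closure; apply: subgroupM (XW _ Xx) => //.
by apply: subgroupV => //; exact/XW/sX.
Qed.
End MaximalCompactNormal.

(** * Commuting conjugations on the quotient *)

Section QuotientAction.
Variables (T : topologicalType) (G : topGroup T) (A N : set T).
Local Notation "x ** y" := (tg_mul G x y) (at level 40, left associativity).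
Local Notation "x ^-1" := (tg_inv G x).
Local Notation conj := (tg_conj G).

(** The two orders of composing [c g] and [c h] differ by the action of a commutator; it lies in
    [A], hence acts trivially on the abelian quotient. *)
Lemma abelian_quotient_action :
  is_normal_subgroup G A -> is_normal_subgroup G N -> N `<=` A -> derived G `<=` A ->
  (forall a b, A a -> A b -> N (Defs.commg G a b)) ->
  exists (M : zmodType) (phi : T -> M) (c : T -> M -> M),
  [/\ forall x y, A x -> A y -> phi (x ** y) = phi x + phi y,
      forall u, exists2 x, A x & phi x = u &
      forall x y, A x -> A y -> (phi x = phi y <-> N (x^-1 ** y))] /\
  [/\ forall g a, A a -> c g (phi a) = phi (conj g a),
      forall g u v, c g (u - v) = c g u - c g v,
      forall g h u, c g (c h u) = c (g ** h) u &
      forall g h u, c g (c h u) = c h (c g u)].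
Proof.
move=> nA nN NA DA commN; have gA := normal_subgroup nA; have gN := normal_subgroup nN.
have [M [phi [phiM phi_surj phi_eq]]] := abelian_quotient gA gN NA commN.
have phi_div' := phi_div gA phiM.
have /choice[r hr] : forall u, exists x, A x /\ phi x = u.
  by move=> u; have [x Ax xu] := phi_surj u; exists x.
pose c (g : T) (u : M) := phi (conj g (r u)).
have Ac g a : A a -> A (conj g a) by exact: normal_conj.
have cphi g a : A a -> c g (phi a) = phi (conj g a).
  move=> Aa; have [Ar ra] := hr (phi a); apply/phi_eq; [exact: Ac|exact: Ac|].
  by rewrite -conjV -conjM; apply: normal_conj => //; exact/phi_eq.
have cB g u v : c g (u - v) = c g u - c g v.
  have [a Aa <-] := phi_surj u; have [b Ab <-] := phi_surj v.
  rewrite -phi_div' // !cphi //; last by apply: subgroupM => //; exact: subgroupV.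
  by rewrite conjM conjV phi_div' //; exact: Ac.
have cM g h u : c g (c h u) = c (g ** h) u.
  by have [a Aa <-] := phi_surj u; rewrite !cphi ?conj_conj //; exact: Ac.
have cC g h u : c g (c h u) = c h (c g u).
  rewrite !cM swap_commg -cM; congr (c _ _).
  have [a Aa <-] := phi_surj u; set d := Defs.commg _ _ _.
  have Ad : A d by apply: DA; exact: mem_derived.
  have Ada : A (d ** a) by exact: subgroupM.
  by rewrite cphi // /tg_conj phi_div' // phiM // addrAC subrr add0r.
by exists M, phi, c.
Qed.
End QuotientAction.

(** * Compactness of [W] *)

Section CompactW.
Variables (T : topologicalType) (G : topGroup T).
Local Notation "x ** y" := (tg_mul G x y) (at level 40, left associativity).
Local Notation "x ^-1" := (tg_inv G x).
Local Notation one := (tg_one G).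
Local Notation W := (W G).
Local Notation conj := (tg_conj G).
Hypothesis hT : hausdorff_space T.
Variables (C0 S : set T).
Hypotheses (cC0 : compact C0) (nC0 : nbhs one C0).
Hypotheses (cS : compact S) (genS : gen_subgroup G S = [set: T]).
Hypothesis symS : forall s, S s -> S (s^-1).

Lemma nbhs_seq (I : eqType) (s : seq I) (Q : I -> set T) (x : T) :
  (forall i, i \in s -> nbhs x (Q i)) -> nbhs x [set y | forall i, i \in s -> Q i y].
Proof.
elim: s => [|a s IH] hs; first by apply: filterE.
have : nbhs x (Q a `&` [set y | forall i, i \in s -> Q i y]).
  apply: filterI; first by apply: hs; exact: mem_head.
  by apply: IH => i si; apply: hs; rewrite inE si orbT.
by apply: filterS => y [Qa hy] i; rewrite inE => /orP[/eqP ->|/hy].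
Qed.

Section ModuleW.
Variables (A N K : set T).
Hypotheses (clA : closed A) (nA : is_normal_subgroup G A) (DA : derived G `<=` A).
Hypotheses (cN : compact N) (nN : is_normal_subgroup G N) (NA : N `<=` A).
Hypothesis commN : forall a b, A a -> A b -> N (Defs.commg G a b).
Hypotheses (cK : compact K) (KA : K `<=` A).
Hypothesis AK : A `<=` mulset G K (closure (derived G)).

(** Modulo [N], [A] is a module over the conjugations by a finite list [ts], generated by a finite
    list [E] up to the bounded set [V]. By [noetherian_mod], one compact normal subgroup [P] inside
    [A] has an image containing those of all others, so the set in question is closed in the compact
    product [P N]. *)
Lemma compact_WI : compact (W `&` A).
Proof.
have gA := normal_subgroup nA; have gN := normal_subgroup nN.
have [M [phi [c [[phiM phi_surj phi_eq] [cphi cB cM cC]]]]] :=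
  abelian_quotient_action nA nN NA DA commN.
have phi_div' := phi_div gA phiM.
have Ac g a : A a -> A (conj g a) by exact: normal_conj.
have /choice[r hr] : forall u, exists x, A x /\ phi x = u.
  by move=> u; have [x Ax xu] := phi_surj u; exists x.
have cD g u v : c g (u + v) = c g u + c g v.
  have c0 : c g 0 = 0 by rewrite -[X in c g X](subrr 0) cB subrr.
  by rewrite -[in LHS](opprK v) cB -[- v]sub0r cB c0 sub0r opprK.
pose nb := quo_nb G A phi; pose V := quo_ball A phi C0.
have nV : nb V := quo_nb_ball A phi nC0.
have bV : bounded nb V := bounded_ball gA phiM cC0 clA.
have V0 : V 0 := quo_nb0 gA phiM nV.
have bimg X : compact X -> X `<=` A -> bounded nb (phi @` X).
  exact: (bounded_image gA phiM).
pose cV := [set z | exists a b, [/\ S a, (C0 `&` A) b & z = conj (a, b).1 (a, b).2]].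
pose cSS := [set z | exists a b, [/\ S a, S b & z = Defs.commg G (a, b).1 (a, b).2]].
(* [zspan E + V] is to absorb [V - V], the conjugates of [V] by [S], the commutators of elements of
   [S], and [K]. *)
have [E hE] : exists E : seq M, sumset V [set z | V (- z)] `|` (phi @` cV) `|`
    (phi @` cSS) `|` (phi @` K) `<=` sumset (zspan E) V.
  apply: (bounded_cover nC0); apply: boundedU; last exact: bimg.
  have b0 := quo_nb0 gA phiM; have bh := quo_nb_half gA phiM.
  apply: boundedU; last first.
    apply: bimg => [|_ [a [b [_ _ ->]]]]; last by apply: DA; exact: mem_derived.
    exact: (compact_image2 (@continuous_commg _ G)).
  apply: boundedU; last first.
    apply: bimg => [|_ [a [b [_ [_ Ab] ->]]]]; last exact: Ac.
    apply: (compact_image2 (f := fun p : T * T => conj p.1 p.2)) => //.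
      by apply: continuous_conj; [exact: continuous_fst|exact: continuous_snd].
    exact: compact_closedI.
  by apply: bounded_sumset => //; exact: boundedN.
have VB x y : V x -> V y -> sumset (zspan E) V (x - y).
  move=> Vx Vy; apply: hE; do 3 left; exists x => //=.
  by rewrite (_ : - _ = y) //; abel.
have Vc s x : S s -> V x -> sumset (zspan E) V (c s x).
  move=> Ss [a [Aa Ca] <-]; rewrite cphi //; apply: hE; do 2 left; right.
  by exists (conj s a) => //; exists s, a.
(* Near the identity, elements of [G] move each member of [E] by an element of
   [V]; finitely many translates of this neighbourhood cover [S]. *)
pose U := [set n | forall f, f \in E -> C0 (conj n (r f) ** (r f)^-1)].
have nU : nbhs one U.
  apply: nbhs_seq => f _.
  have cf : continuous (fun n => conj n (r f) ** (r f)^-1).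
    apply: continuousM; last exact: continuous_cst.
    by apply: continuous_conj; [exact: continuous_id|exact: continuous_cst].
  by apply: (cf one); rewrite conj_one tg_mulgV.
have [ts [tsS hts]] := compact_finite_translates cS nU.
have UE n f : U n -> f \in E -> V (c n f - f).
  move=> Un fE; have [Ar rf] := hr f; exists (conj n (r f) ** (r f)^-1).
    by split; [apply: subgroupM; [|exact: Ac|exact: subgroupV]|exact: Un].
  by rewrite phi_div' ?rf -?cphi ?rf //; exact: Ac.
pose O := sumset (mspan c ts E) V.
have [gm im] := submod_mspan cB cC ts E.
have Em : zspan E `<=` mspan c ts E.
  by apply: zspan_min => // f; exact: mem_mspan.
have gO : subgrp O by exact: (subgrp_sumset gm Em V0 VB).
have VO : sumset (zspan E) V `<=` O by exact: sumsetS.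
have O_ts g x : g \in ts -> O x -> O (c g x).
  move=> gts [d md Vd]; rewrite (_ : x = d + (x - d)); last abel.
  rewrite cD; apply: sumset_addl => //; first exact: im.
  by apply: VO; apply: Vc => //; exact: tsS.
(* [s] is written as [g (g^-1 s)] with [g] in [ts] and [g^-1 s] in [U]; the second factor moves the
   generators in [E] by elements of [V] only. *)
have O_S s x : S s -> O x -> O (c s x).
  move=> Ss [d md Vd]; rewrite (_ : x = d + (x - d)); last abel.
  rewrite cD; apply: subgrpD => //; last by apply: VO; exact: Vc.
  move: d md {Vd}; apply: (@mspan_min _ _ _ _ _ [set d | O (c s d)]).
    split; last by move=> g gts y /= hy; rewrite cC; exact: O_ts.
    split=> [|y z hy hz] /=; last by rewrite cB; exact: gO.2.
    by rewrite -[X in c s X](subrr 0) cB subrr; exact: gO.1.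
  move=> f fE /=; have [g gts hg] := hts s Ss.
  rewrite -(tgKV G g s) -cM; apply: O_ts => //.
  rewrite -(subrK f (c _ f)); apply: subgrpD => //.
    by apply: VO; apply: sumset_memr; [exact: subgrp_zspan|exact: UE].
  by apply: sumset_meml => //; exact: mem_mspan.
(* This preimage is a normal subgroup containing the commutators of generators, hence the derived
   subgroup. It also contains [K] and the elements of [A] in [C0], hence the closure of the derived
   subgroup and all of [A]. *)
pose OT := [set a | A a /\ O (phi a)].
have gOT : is_subgroup G OT := subgroup_preimage gA phiM gO.
have nOT : is_normal_subgroup G OT.
  apply: (normal_gen genS symS gOT) => s x Ss [Ax Ox].
  by split; [exact: Ac|rewrite -cphi //; exact: O_S].
have DOT : derived G `<=` OT.
  apply: (derived_sub_gen genS nOT) => s t Ss St.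
  split; first by apply: DA; exact: mem_derived.
  apply/VO/hE; left; right; exists (Defs.commg G s t) => //.
  by exists s, t.
have AO a : A a -> O (phi a).
  suff : A `<=` OT by move=> h /h[].
  move=> x /AK[k [d [Kk cld ->]]]; apply: subgroupM => //.
    by split; [exact: KA|apply/VO/hE; right; exists k].
  have [d' Dd' hd] := closure_translate cld nC0.
  rewrite -(tgKV G d' d); apply: subgroupM => //; first exact: DOT.
  have Ad : A (d'^-1 ** d).
    apply: subgroupM => //; first by apply: subgroupV => //; exact: DA.
    by apply: clA; apply: closureS cld.
  split=> //; apply: VO; apply: sumset_memr; first exact: subgrp_zspan.
  by exists (d'^-1 ** d).
pose J := {P : set T | compact_normal G P /\ P `<=` A}.
pose Ms (P : J) := phi @` (sval P).
have oneA : compact_normal G [set one] /\ [set one] `<=` A.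
  by split; [exact: compact_normal_one|move=> _ ->; exact: subgroup1].
have dirM : directed Ms.
  move=> [P [hP PA]] [Q [hQ QA]].
  have PQA : mulset G P Q `<=` A.
    by move=> _ [p [q [/PA Ap /QA Aq ->]]]; exact: subgroupM.
  exists (exist _ (mulset G P Q) (Logic.conj (compact_normalM hP hQ) PQA)).
  split=> _ [p Pp <-]; exists p => //=.
    by apply: sub_mulsetl => //; exact: normal_subgroup hQ.2.
  by apply: sub_mulsetr => //; exact: normal_subgroup hP.2.
have subM P : submod c ts (Ms P).
  case: P => P [hP PA]; split.
    by apply: (subgrp_image gA phiM) => //; exact: normal_subgroup hP.2.
  move=> g _ _ [p Pp <-]; rewrite cphi; last exact: (PA _ Pp).
  by exists (conj g p) => //; exact: (normal_conj g hP.2 Pp).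
(* Inside [zspan F + V] the images of compact normal subgroups give bounded subgroups, all contained
   in one bounded set [K']. The lift of [K'], cut with [W] and [A], is a compact subset of [W], and
   [compact_sub_W] puts it in a single compact normal subgroup. *)
have base F : {subset E <= F} -> noetherian_on Ms (sumset (zspan F) V).
  move=> sEF; have gF := subgrp_zspan F.
  have gFV : subgrp (sumset (zspan F) V).
    exact: (subgrp_sumset gF (zspan_sub sEF) V0 VB).
  have [K' bK' hK'] := quo_bounded_subgroups gA phiM cC0 nC0 clA F bV.
  have [Kc cKc hKc] := bounded_preimage gA phiM phi_surj phi_eq cC0 nC0 bK'.
  have clWA : closed (W `&` A).
    by apply: closedI => //; exact: (closed_W cC0 nC0 cS genS symS).
  have cX : compact (mulset G Kc N `&` (W `&` A)).
    by apply: compact_closedI => //; exact: compact_mulset.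
  have [P1 hP1 XP1] := compact_sub_W cC0 nC0 cS genS symS cX (subset_trans (@subIsetr _ _ _) (@subIsetl _ _ _)).
  have hP2 := compact_normalI clA nA hP1.
  exists (exist _ (P1 `&` A) (Logic.conj hP2 (@subIsetr _ P1 A))) => -[P [hP PA]].
  move=> u [[p Pp <-] up]; exists p => //; split; last exact: (PA _ Pp).
  apply: XP1; split; last by split; [exact: (W_intro hP Pp)|exact: (PA _ Pp)].
  apply: hKc; first exact: (PA _ Pp).
  apply: (hK' (Ms (exist _ P (Logic.conj hP PA)) `&` sumset (zspan F) V)).
  - by apply: subgrpI => //; exact: (subM (exist _ P (Logic.conj hP PA))).1.
  - apply: (@boundedS _ _ _ (phi @` P)); first by move=> ? [].
    by apply: bimg => //; exact: hP.1.
  - by move=> ? [].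
  - by split=> //; exists p.
have Vts g : g \in ts -> forall x, V x -> sumset (zspan E) V (c g x).
  by move=> gts x; apply: Vc; exact: tsS.
have [[P [hP PA]] hPO] := noetherian_mod cB cC (exist _ _ oneA) dirM subM V0 VB Vts base
  (fun f fE => fE).
apply: (@subclosed_compact _ _ (mulset G P N)).
- by apply: closedI => //; exact: (closed_W cC0 nC0 cS genS symS).
- by apply: compact_mulset => //; exact: hP.1.
move=> w [/W_elim[P' hP' P'w] Aw].
have hP'' := Logic.conj (compact_normalI clA nA hP') (@subIsetr _ P' A).
have [|p Pp pw] := hPO (exist _ (P' `&` A) hP'') (phi w).
  by split; [exists w|exact: AO].
exists p, (p^-1 ** w); split=> //; last by rewrite tgKV.
by apply/phi_eq => //; exact: (PA _ Pp).
Qed.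
End ModuleW.

(** Modulo [A], the group is abelian and finitely generated up to a bounded set, so the images of
    its compact normal subgroups lie in a common bounded set. *)
Lemma W_mod_abelian A : closed A -> is_normal_subgroup G A -> derived G `<=` A ->
  exists2 K, compact K & W `<=` mulset G K A.
Proof.
move=> clA nA DA; have gA := normal_subgroup nA; have gT := subgroup_setT G.
have commA a b : [set: T] a -> [set: T] b -> A (Defs.commg G a b).
  by move=> _ _; apply: DA; exact: mem_derived.
have [M [phi [phiM phi_surj phi_eq]]] := abelian_quotient gT gA (@subsetT _ A) commA.
have nV := quo_nb_ball _ _ nC0 : quo_nb G [set: T] phi (quo_ball [set: T] phi C0).
have bV := bounded_ball gT phiM cC0 closedT.
have b0 := quo_nb0 gT phiM; have bh := quo_nb_half gT phiM.
set V := quo_ball _ _ _ in nV bV; have V0 : V 0 := b0 _ nV.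
(* With this choice [zspan E + V] is a subgroup containing the image of [S], hence the whole
   quotient. *)
have [E hE] : exists E : seq M, sumset V [set z | V (- z)] `|` (phi @` S) `<=`
    sumset (zspan E) V.
  apply: (bounded_cover nC0); apply: boundedU; last exact: bounded_image.
  by apply: bounded_sumset => //; exact: boundedN.
have gE := subgrp_zspan E.
have gEV : subgrp (sumset (zspan E) V).
  apply: (subgrp_sumset gE (fun x h => h) V0) => x y Vx Vy.
  apply: hE; left; exists x => //=.
  by rewrite (_ : - _ = y) //; abel.
have allE u : sumset (zspan E) V u.
  have [x _ <-] := phi_surj u; have : gen_subgroup G S x by rewrite genS.
  move/(_ _ (subgroup_preimage gT phiM gEV)); case=> // s Ss.
  by split=> //; apply: hE; right; exists s.
have [K' bK' hK'] := quo_bounded_subgroups gT phiM cC0 nC0 closedT E bV.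
have [Kc cKc hKc] := bounded_preimage gT phiM phi_surj phi_eq cC0 nC0 bK'.
exists Kc => // w /W_elim[P [cP nP] Pw]; apply: hKc => //.
apply: (hK' (phi @` P)).
- by apply: (subgrp_image gT phiM) => //; exact: normal_subgroup.
- exact: bounded_image.
- by move=> u _; exact: allE.
- by exists w.
Qed.

Theorem compact_W : metabelian G -> compact W.
Proof.
move=> metG; set D := derived G; pose A := closure D.
have nD : is_normal_subgroup G D := normal_derived G.
have gD := normal_subgroup nD.
have clA : closed A by exact: closed_closure.
have nA : is_normal_subgroup G A := normal_closure nD.
have gA := normal_subgroup nA; have DA : D `<=` A by exact: subset_closure.
(* First application: [A] is itself abelian and is the closure of [D], so [N] and [K] are
   trivial. *)
have cWA : compact (W `&` A).
  apply: (@compact_WI A [set one] [set one]) => //.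
  - exact: compact_set1.
  - exact: normal_one.
  - by move=> _ ->; exact: subgroup1.
  - by move=> a b; exact: closure_derived_commute.
  - exact: compact_set1.
  - by move=> _ ->; exact: subgroup1.
  - by move=> a Aa; exists one, a; rewrite tg_mul1g.
have nW := normal_W G; have gW := normal_subgroup nW.
have clW := closed_W cC0 nC0 cS genS symS.
have nWA := normalI nW nA; have gWA := normal_subgroup nWA.
have clWA : closed (W `&` A) by exact: closedI.
pose B := mulset G W D; have nB : is_normal_subgroup G B by exact: normal_mulset.
have gB := normal_subgroup nB.
have nA' := normal_closure nB; have gA' := normal_subgroup nA'.
have WB : W `<=` B by exact: sub_mulsetl.
have DB : D `<=` B by exact: sub_mulsetr.
have [K1 cK1 WK1] := W_mod_abelian clA nA DA.
(* [W D] lies in the closed set [K1 A]; thus [closure B] is the closure of [D] up to a compact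
   factor, as [compact_WI] requires. *)
have BK : closure B `<=` mulset G K1 A.
  rewrite [X in _ `<=` X](closure_id _).1; last exact: closed_mulset.
  apply: closureS => _ [w [d [/WK1[k [a [Kk Aa ->]]] Dd ->]]].
  by exists k, (a ** d); rewrite tgA; split=> //; apply: (subgroupM gA) => //; exact: DA.
(* Modulo [W], elements of [B] come from the abelian group [D], so their commutators lie in [W];
   being commutators, they also lie in [A]. *)
have commB a b : closure B a -> closure B b -> (W `&` A) (Defs.commg G a b).
  move=> Ba Bb; apply: clWA.
  apply: (closure_image2 (@continuous_commg _ G)) Ba Bb.
  move=> _ _ [w [d [Ww Dd ->]]] [w' [d' [Ww' Dd' ->]]].
  split; last by apply: DA; exact: mem_derived.
  rewrite (_ : Defs.commg _ _ _ = conj ((d' ** d)^-1) ((w' ** conj d' w)^-1 ** (w ** conj d w'))).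
    apply: (normal_conj _ nW); apply: (subgroupM gW); [apply: (subgroupV gW)|];
      by apply: (subgroupM gW) => //; exact: (normal_conj _ nW).
  by rewrite /Defs.commg /tg_conj !tgE -(metG d d') // !tgE.
suff : compact (W `&` closure B).
  rewrite (_ : _ `&` _ = W) //; apply/setIidPl.
  by apply: subset_trans WB _; exact: subset_closure.
apply: (@compact_WI (closure B) (W `&` A) (K1 `&` closure B)) => //.
- exact: closed_closure.
- by apply: subset_trans DB _; exact: subset_closure.
- by move=> x [Wx _]; apply: subset_closure; exact: WB.
- by apply: compact_closedI => //; exact: closed_closure.
- move=> x Bx; have [k [a [Kk Aa xE]]] := BK x Bx.
  exists k, a; split=> //; split=> //.
  rewrite (_ : k = x ** a^-1); last by rewrite xE !tgE.
  apply: (subgroupM gA') => //; apply: (subgroupV gA').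
  by apply: closureS Aa.
Qed.
End CompactW.

(** * Compact open subgroups and the closedness of the derived subgroup *)

Section TotallyDisconnected.
Variables (T : topologicalType) (G : topGroup T).
Local Notation "x ** y" := (tg_mul G x y) (at level 40, left associativity).
Local Notation "x ^-1" := (tg_inv G x).
Local Notation one := (tg_one G).
Local Notation conj := (tg_conj G).
Hypothesis hT : hausdorff_space T.
Variables (C0 : set T).
Hypotheses (cC0 : compact C0) (nC0 : nbhs one C0).

(** Clopen sets are taken relative to [C0], since [T] is only locally compact; their intersection is
    the quasi-component of [one] in [C0]. *)
Definition relclopen (K : set T) :=
  [/\ closed K, K one & exists2 O, open O & K = C0 `&` O].

Lemma relclopenI K K' : relclopen K -> relclopen K' -> relclopen (K `&` K').
Proof.
move=> [cK K1 [Z oZ KE]] [cK' K'1 [Z' oZ' KE']]; split=> //; first exact: closedI.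
by exists (Z `&` Z'); [exact: openI|rewrite KE KE' setIACA setIid].
Qed.

Lemma relclopen_C0 : relclopen C0.
Proof.
split; [exact: compact_closed|exact: nbhs_singleton|].
by exists setT; [exact: openT|rewrite setIT].
Qed.

Lemma relclopen_seq (s : seq (set T)) : (forall K, K \in s -> relclopen K) ->
  relclopen (C0 `&` [set x | forall K, K \in s -> K x]).
Proof.
elim: s => [|K s IH] hs.
  rewrite (_ : [set _ | _] = setT) ?setIT; first exact: relclopen_C0.
  by apply/seteqP; split.
rewrite (_ : C0 `&` _ = K `&` (C0 `&` [set x | forall K, K \in s -> K x])).
  apply: relclopenI; first by apply: hs; exact: mem_head.
  by apply: IH => K' K's; apply: hs; rewrite inE K's orbT.
apply/seteqP; split=> x [].
  move=> Cx hx; split; first by apply: hx; exact: mem_head.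
  by split=> // K' K's; apply: hx; rewrite inE K's orbT.
by move=> Kx [Cx hx]; split=> // K'; rewrite inE => /orP[/eqP ->|/hx].
Qed.

(** By compactness of the part of [C0] outside [O], finitely many relatively clopen sets already
    have their intersection inside [O]. *)
Lemma relclopen_separate (O : set T) : open O ->
  (forall x, (forall K, relclopen K -> K x) -> O x) ->
  exists2 K, relclopen K & K `<=` O.
Proof.
move=> oO hO; have cX : compact (C0 `&` ~` O).
  by apply: compact_closedI => //; exact: open_closedC.
have [x [Cx nOx]|s [sR hs]] := @compact_seq_cover _ _ relclopen (fun K => ~` K) _ cX.
  have [K rK nKx] : exists2 K, relclopen K & ~ K x.
    apply: contrapT => h; apply: nOx; apply: hO => K rK.
    by apply: contrapT => nK; apply: h; exists K.
  exists K => //; apply: open_nbhs_nbhs; split=> //.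
  by apply: closed_openC; case: rK.
exists (C0 `&` [set x | forall K, K \in s -> K x]); first exact: relclopen_seq.
move=> x [Cx hx]; apply: contrapT => nO; have [|K Ks nK] := hs x; first by split.
by apply: nK; exact: hx.
Qed.

Lemma open_mulset (X U : set T) : open U -> open (mulset G X U).
Proof.
move=> oU; rewrite openE => _ [x [u [Xx Uu ->]]].
have nU : nbhs (x^-1 ** (x ** u)) U by rewrite tgK; exact: open_nbhs_nbhs.
apply: filterS (nbhs_mull nU) => y Uy.
by exists x, (x^-1 ** y); rewrite tgKV.
Qed.

(** Disjoint closed pieces [X] and [Y], with [one] in [X], have disjoint open neighbourhoods [O1]
    and [O2]. Some relatively clopen [K] lies in their union; its part in [O1] is again relatively
    clopen, so it contains [Y], which must be empty. *)
Lemma relclopen_connected : connected [set x | forall K, relclopen K -> K x].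
Proof.
set R := [set _ | _].
have RC : R `<=` C0 by move=> x; apply; exact: relclopen_C0.
have clR : closed R.
  move=> x clx K rK; have [cK _ _] := rK; apply: cK.
  by apply: closureS clx => y; exact.
have R1 : R one by move=> K [].
have sep X Y : closed X -> closed Y -> X `&` Y = set0 -> X `|` Y = R -> X one -> Y = set0.
  move=> clX clY XY0 XYR X1.
  have cX : compact X.
    by apply: subclosed_compact cC0 _ => // x Xx; apply: RC; rewrite -XYR; left.
  have nU : nbhs one [set u | forall x, X x -> (~` Y) (x ** u)].
    apply: (@compact_tube _ _ _ (fun p => p.2 ** p.1)) => //.
      by apply: continuousM; [exact: continuous_snd|exact: continuous_fst].
    move=> x Xx; rewrite /= tg_mulg1; apply: open_nbhs_nbhs; split.
      exact: closed_openC.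
    by move=> Yx; have : (X `&` Y) x by []; rewrite XY0.
  have [U' nU' hU'] := nbhs_split nU.
  pose O1 := mulset G X (interior U'); pose O2 := mulset G Y (interior U').
  have o1 : open O1 by apply: open_mulset; exact: open_interior.
  have o2 : open O2 by apply: open_mulset; exact: open_interior.
  have i1 : interior U' one by [].
  have XO x : X x -> O1 x by move=> Xx; exists x, one; rewrite tg_mulg1.
  have YO y : Y y -> O2 y by move=> Yy; exists y, one; rewrite tg_mulg1.
  have O12 z : O1 z -> O2 z -> False.
    move=> [x [u [Xx /interior_subset Uu ->]]] [y [v [Yy /interior_subset Uv xy]]].
    apply: (hU' u v Uu Uv x Xx); rewrite (_ : _ ** _ = y) //.
    by rewrite -tgA xy !tgE.
  have [||K rK KO] := @relclopen_separate (O1 `|` O2).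
  - exact: openU.
  - move=> x Rx; have : R x by []. rewrite -XYR => -[/XO|/YO]; by [left|right].
  have rK1 : relclopen (K `&` O1).
    have [cK K1 [Z oZ KE]] := rK; split.
    - rewrite (_ : K `&` O1 = K `&` ~` O2).
        by apply: closedI => //; exact: open_closedC.
      apply/seteqP; split=> x [Kx hx]; split=> //; first by move=> /(O12 _ hx).
      by have [] := KO x Kx.
    - by split=> //; exact: XO.
    - by exists (Z `&` O1); [exact: openI|rewrite KE setIA].
  apply/seteqP; split=> // y Yy; apply: (O12 y); last exact: YO.
  by have Ry : R y by [rewrite -XYR; right]; have [] := Ry _ rK1.
move=> B B0 [Z oZ BZ] [Z' cZ' BZ'].
have clB : closed B by rewrite BZ'; exact: closedI.
have clB' : closed (R `\` B).
  rewrite (_ : R `\` B = R `&` ~` Z).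
    by apply: closedI => //; exact: open_closedC.
  by apply/seteqP; split=> x [Rx hx]; split=> // h; apply: hx; rewrite ?BZ //;
    move: h; rewrite BZ => -[].
have BR : B `<=` R by rewrite BZ; exact: subIsetl.
have [B1|nB1] := pselect (B one).
  apply/seteqP; split=> // x Rx; apply: contrapT => nBx.
  have /seteqP[h _] : R `\` B = set0.
    by apply: (sep B) => //; [rewrite setIDA setIC -setIDA setDv setI0|rewrite setUDr
      setDv setD0; exact/setUidPr].
  exact: (h x).
have B00 : B = set0.
  apply: (sep (R `\` B)) => //; first by rewrite setDE -setIA setICl setI0.
  by rewrite setUC setUDr setDv setD0; exact/setUidPr.
by move: B0; rewrite B00 => -[].
Qed.

Hypothesis td : totally_disconnected [set: T].

(** The quasi-component of [one] is a point, so some relatively clopen set lies in the interior of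
    [C0], where relatively open sets are open. *)
Lemma compact_open_nbhs : exists K, [/\ compact K, open K, K one & K `<=` C0].
Proof.
have [||K rK KC] := @relclopen_separate (interior C0).
- exact: open_interior.
- move=> x Rx; suff -> : x = one by [].
  have : connected_component [set: T] one x.
    exists [set x | forall K, relclopen K -> K x] => //.
    by split=> //; [move=> K []|exact: relclopen_connected].
  by rewrite td.
have [cK K1 [Z oZ KE]] := rK.
exists K; split=> //.
- apply: subclosed_compact cC0 _ => //; rewrite KE; exact: subIsetl.
- rewrite (_ : K = interior C0 `&` Z); first by apply: openI => //; exact: open_interior.
  apply/seteqP; split=> x; last by move=> [/interior_subset Cx Zx]; rewrite KE.
  by move=> Kx; split; [exact: KC|move: Kx; rewrite KE => -[]].
- by rewrite KE; exact: subIsetl.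
Qed.

Lemma closed_open_subgroup H : is_subgroup G H -> nbhs one H -> closed H.
Proof.
move=> gH nH x clx; have [a Ha hax] := closure_translate clx nH.
by rewrite -(tgKV G a x); exact: subgroupM.
Qed.

(** The [g] such that [g] and [g^-1] map [K] into itself form a subgroup, a neighbourhood of [one]
    by the tube lemma; it lies in [K] because [K] contains [one]. *)
Lemma van_dantzig : exists H, [/\ compact H, is_subgroup G H & nbhs one H].
Proof.
have [K [cK oK K1 KC]] := compact_open_nbhs.
pose H := [set g | (forall k, K k -> K (g ** k)) /\ (forall k, K k -> K (g^-1 ** k))].
have gH : is_subgroup G H.
  split; first by split=> k Kk; rewrite ?tg_inv1 tg_mul1g.
  split=> [g h [g1 g2] [h1 h2]|g [g1 g2]]; last by split=> // k; rewrite tg_invK; exact: g1.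
  by split=> k Kk; rewrite ?tg_invM tgA; [exact/g1/h1|exact/h2/g2].
have nH : nbhs one H.
  apply: filterI.
    apply: (@compact_tube _ _ _ (fun p => p.1 ** p.2)) => //; first exact: tg_mul_cont.
    by move=> k Kk; rewrite /= tg_mul1g; exact: open_nbhs_nbhs.
  apply: (@compact_tube _ _ _ (fun p => p.1^-1 ** p.2)) => //.
    by apply: continuousM; [apply: continuousV; exact: continuous_fst|exact: continuous_snd].
  by move=> k Kk; rewrite /= tg_inv1 tg_mul1g; exact: open_nbhs_nbhs.
exists H; split=> //; apply: subclosed_compact cK _; first exact: closed_open_subgroup.
by move=> g [/(_ _ K1)]; rewrite tg_mulg1.
Qed.

Variable S : set T.
Hypotheses (cS : compact S) (genS : gen_subgroup G S = [set: T]).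
Hypothesis symS : forall s, S s -> S (s^-1).

Theorem closed_derived : metabelian G -> W G = [set one] -> closed (derived G).
Proof.
move=> metG W1; set D := derived G; pose A := closure D.
have nD : is_normal_subgroup G D := normal_derived G.
have gD := normal_subgroup nD.
have clA : closed A by exact: closed_closure.
have nA : is_normal_subgroup G A := normal_closure nD.
have gA := normal_subgroup nA; have DA : D `<=` A by exact: subset_closure.
have commA a b : A a -> A b -> [set one] (Defs.commg G a b).
  exact: closure_derived_commute.
have oneA : [set one] `<=` A by move=> _ ->; exact: subgroup1.
have [M [phi [c [[phiM phi_surj phi_eq] [cphi cB cM cC]]]]] :=
  abelian_quotient_action nA (normal_one G) oneA DA commA.
have Ac g a : A a -> A (conj g a) by exact: normal_conj.
have phi_inj a b : A a -> A b -> phi a = phi b -> a = b.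
  by move=> Aa Ab /phi_eq -/(_ Aa Ab) ab; rewrite -(tgKV G a b) ab tg_mulg1.
have conjC g h a : A a -> conj g (conj h a) = conj h (conj g a).
  move=> Aa; apply: phi_inj; [exact/Ac/Ac|exact/Ac/Ac|].
  by rewrite -!cphi //; exact: Ac.
have [H [cH gH nH]] := van_dantzig.
have clH := closed_open_subgroup gH nH.
have Hnbhs x : H x -> nbhs x H.
  move=> Hx; apply: filterS (nbhs_translate x nH) => y Hy.
  by rewrite -(tgKV G x y); exact: subgroupM.
(* Finitely many translates of the neighbourhood [St] cover [S], which reduces conjugation by [S] to
   conjugation by [ts]. *)
pose St := [set g | forall l, (H `&` A) l -> H (conj g l)].
have nSt : nbhs one St.
  apply: (@compact_tube _ _ _ (fun p => conj p.1 p.2)).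
  - by apply: continuous_conj; [exact: continuous_fst|exact: continuous_snd].
  - exact: compact_closedI.
  - by move=> l [Hl _]; rewrite /= conj_one; exact: Hnbhs.
have [ts [tsS hts]] := compact_finite_translates cS nSt.
pose hs := ts ++ map (tg_inv G) ts.
pose L := fix L n := if n is n'.+1 then
  [set a | L n' a /\ forall h, h \in hs -> L n' (conj h a)] else H `&` A.
have LA n : L n `<=` A by elim: n => [|n IH] a; [case|case=> /IH].
have gL n : is_subgroup G (L n).
  elim: n => [|n IH] /=.
    split; first by split; [exact: (subgroup1 gH)|exact: (subgroup1 gA)].
    split=> [x y [? ?] [? ?]|x [? ?]]; first by split; [exact: (subgroupM gH)|exact: (subgroupM gA)].
    by split; [exact: (subgroupV gH)|exact: (subgroupV gA)].
  split; first by split=> [|h _]; rewrite ?conj1; exact: subgroup1.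
  split=> [x y [Lx hx] [Ly hy]|x [Lx hx]].
    by split=> [|h hh]; rewrite ?conjM; apply: subgroupM => //; [exact: hx|exact: hy].
  by split=> [|h hh]; rewrite ?conjV; apply: subgroupV => //; exact: hx.
have clL n : closed (L n).
  elim: n => [|n IH] /=; first exact: closedI.
  move=> x clx; split; first by apply: IH; apply: closureS clx => y [].
  move=> h hh; apply: IH; apply: (closure_image (f := conj h)) clx; last by move=> a [_]; exact.
  by apply: continuous_conj; [exact: continuous_cst|exact: continuous_id].
have L_le m n : (m <= n)%N -> L n `<=` L m.
  move=> /subnK <-; elim: (n - m)%N => // k IH; rewrite addSn.
  by apply: subset_trans IH => x [].
have cL n : compact (L n).
  apply: (@subclosed_compact _ _ (H `&` A)) => //; first exact: compact_closedI.
  exact: (L_le 0%N).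
have nL n : exists2 O, nbhs one O & forall a, A a -> O a -> L n a.
  elim: n => [|n [Z nZ hZ]] /=; first by exists H.
  exists (Z `&` [set a | forall h, h \in hs -> Z (conj h a)]).
    apply: filterI => //; apply: nbhs_seq => h _.
    have ch : continuous (conj h).
      by apply: continuous_conj; [exact: continuous_cst|exact: continuous_id].
    by apply: (ch one); rewrite conj1.
  move=> a Aa [Za hZa]; split=> [|h hh]; first exact: hZ.
  by apply: hZ; [exact: Ac|exact: hZa].
(* Conjugations commute on [A], so stability of [L 0] passes to every level. *)
have L_St n g a : St g -> L n a -> L n (conj g a).
  move=> Sg; elim: n a => [|n IH] a /=.
    by move=> La; split; [exact: Sg|case: La => _; exact: Ac].
  move=> [La hLa]; split=> [|h hh]; first exact: IH.
  by rewrite conjC; [apply: IH; exact: hLa|exact: LA La].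
(* The intersection of the [L n] is compact and normal: conjugating by an element of [ts] costs one
   level, by an element of [St] none. Hence it lies in [W], which is trivial. *)
have capL x : (forall n, L n x) -> x = one.
  move=> Lx; suff : W G x by rewrite W1.
  exists [set x | forall n, L n x]; split=> //.
    apply: (@subclosed_compact _ _ (L 0%N)) => //.
    by move=> y cly n; apply: clL; apply: closureS cly => z hz; exact: hz.
  apply: (normal_gen genS symS).
    split; first by move=> n; exact: subgroup1.
    split=> [y z Ly Lz n|y Ly n]; first by apply: subgroupM; [exact: gL|exact: Ly|exact: Lz].
    by apply: subgroupV; [exact: gL|exact: Ly].
  move=> s y Ss Ly n; have [g gts hg] := hts s Ss.
  rewrite -(tgKV G g s) -conj_conj.
  have [_] : L n.+1 (conj (g^-1 ** s) y) by apply: L_St => //; exact: Ly.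
  by apply; rewrite mem_cat gts.
pose LM n := phi @` L n.
have LMP n a : A a -> LM n (phi a) -> L n a.
  by move=> Aa [b Lb /phi_inj <-] //; exact: LA Lb.
have gLM n : subgrp (LM n) by exact: (subgrp_image gA phiM (gL n) (LA n)).
have LS n x : LM n.+1 x <-> LM n x /\ forall i, i \in hs -> LM n (c i x).
  have [a Aa <-] := phi_surj x; split.
    move=> /(LMP _ _ Aa)[La hLa]; split; first by exists a.
    by move=> h hh; exists (conj h a); [exact: hLa|rewrite cphi].
  move=> [/(LMP _ _ Aa) La hLa]; exists a => //; split=> // h hh.
  by apply: LMP; [exact: Ac|rewrite -cphi //; exact: hLa].
have [reps repsP] : exists reps : seq M,
    forall x, LM 0%N x -> exists2 y, y \in reps & LM 1%N (x - y).
  have [Z nZ hZ] := nL 1%N; have [s [sL hs']] := compact_finite_translates (cL 0%N) nZ.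
  exists (map phi s) => _ [x Lx <-]; have [y ys Zy] := hs' x Lx.
  have [Ax Ay] : A x /\ A y by split; [exact: LA Lx|exact: LA (sL _ ys)].
  exists (phi y); first exact: map_f.
  exists (y^-1 ** x); last exact: (phi_ldiv gA phiM).
  by apply: hZ => //; apply: (subgroupM gA) => //; exact: (subgroupV gA).
have [n0 hn0] := filtration_stable one cB cC gLM LS repsP.
pose J := dspan c hs (LM n0.+1).
have gJ : subgrp J by exact: subgrp_dspan.
(* Iterating the stabilisation pushes the error to any depth while the correction stays in the fixed
   subgroup [J]. *)
have LMJ n : LM n0 `<=` sumset J (LM (n + n0)%N).
  elim: n => [|n IH] x Lx; first by apply: sumset_memr.
  have [j Jj /hn0] := IH x Lx; move=> /(_ (leq_addl _ _))[k hk Lk].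
  exists (j + k); last by rewrite addSn (_ : _ - _ = x - j - k) //; abel.
  apply: subgrpD => //; apply: dspanS hk => _ [a La <-]; exists a => //.
  by apply: L_le La; rewrite ltnS leq_addl.
(* A compact set of products of commutators lifting [J]. *)
pose DT := fix DT (us : seq T) := if us is i :: us' then
    mulset G ((fun l => conj i l ** l^-1) @` L n0.+1) (DT us') else [set one].
have cDT us : compact (DT us).
  elim: us => [|i us IH]; first exact: compact_set1.
  apply: compact_mulset => //; apply: compact_image => //.
  apply: continuousM; last exact: tg_inv_cont.
  by apply: continuous_conj; [exact: continuous_cst|exact: continuous_id].
have DTD us : DT us `<=` D.
  elim: us => [|i us IH] x /=; first by move=> ->; exact: (subgroup1 gD).
  move=> [_ [b [[l _ <-] /IH Db ->]]]; apply: (subgroupM gD) => //.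
  rewrite (_ : _ ** _ = Defs.commg G (i^-1) (l^-1)); first exact: mem_derived.
  by rewrite /Defs.commg /tg_conj !tgE.
have DTP us a : A a -> dspan c us (LM n0.+1) (phi a) -> DT us a.
  elim: us a => [|i us IH] a Aa /=.
    by rewrite -(phi1 gA phiM) => /phi_inj -> //; exact: (subgroup1 gA).
  move=> [_ [l Ll <-]]; have Al := LA _ _ Ll.
  have Ail : A (conj i l ** l^-1) by apply: (subgroupM gA); [exact: Ac|exact: (subgroupV gA)].
  rewrite cphi // -(phi_div gA phiM) //; last exact: Ac.
  rewrite -(phi_ldiv gA phiM) // => /IH hD.
  exists (conj i l ** l^-1), ((conj i l ** l^-1)^-1 ** a); split.
  - by exists l.
  - by apply: hD; apply: (subgroupM gA) => //; exact: (subgroupV gA).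
  - by rewrite tgKV.
have LJ n a : L n0 a -> exists2 j, DT hs j & L n (j^-1 ** a).
  move=> La; have Aa := LA _ _ La; have [|u Ju Lu] := LMJ n (phi a); first by exists a.
  have [j Aj ju] := phi_surj u; rewrite -ju in Ju Lu.
  exists j; first exact: DTP.
  have : L (n + n0)%N (j^-1 ** a).
    apply: LMP; last by rewrite (phi_ldiv gA phiM).
    by apply: (subgroupM gA) => //; exact: (subgroupV gA).
  by apply: L_le; exact: leq_addr.
(* If [a] avoided [DT hs], compactness would give finitely many levels such that [j^-1 ** a] misses
   one of them for each [j] in [DT hs]; [LJ] at the largest level excludes this. *)
have LD : L n0 `<=` D.
  move=> a La; apply: (DTD hs); apply: contrapT => nDa.
  have [j Dj|s [_ hs']] := @compact_seq_cover _ nat setT (fun n => [set j | ~ L n (j^-1 ** a)]) _ (cDT hs).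
    have [n nLn] : exists n, ~ L n (j^-1 ** a).
      apply/existsNP => Lj; apply: nDa.
      by rewrite -(tgKV G j a) (capL _ Lj) tg_mulg1.
    exists n => //; have cf : continuous (fun j => j^-1 ** a).
      by apply: continuousM; [exact: tg_inv_cont|exact: continuous_cst].
    apply: (cf j (~` L n)); apply: open_nbhs_nbhs; split=> //.
    exact: closed_openC.
  have [j Dj Lj] := LJ (\max_(n <- s) n) a La; have [n ns] := hs' j Dj.
  by apply; apply: L_le Lj; exact: leq_bigmax_seq.
(* Within [A], [D] contains a neighbourhood of [one], so a point of the closure differs from a
   nearby element of [D] by an element of [D]. *)
move=> x clx; have [Z nZ hZ] := nL n0.
have [d Dd hd] := closure_translate clx nZ.
rewrite -(tgKV G d x); apply: (subgroupM gD) => //; apply: LD; apply: hZ => //.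
by apply: (subgroupM gA) => //; apply: (subgroupV gA); exact: DA.
Qed.
End TotallyDisconnected.

(** * The quotient by [W] and the conclusion *)

Lemma W_quotient (T U : topologicalType) (G : topGroup T) (H : topGroup U) (pi : T -> U) C0 :
  compact C0 -> nbhs (tg_one G) C0 -> compact (W G) -> closed (W G) ->
  is_quotient_map G H (W G) pi -> W H = [set tg_one H].
Proof.
move=> cC0 nC0 cW clW [piM pic pio pis pik].
have hW := normal_subgroup (normal_W G).
have pi1 : pi (tg_one G) = tg_one H by apply/pik; exact: subgroup1.
have piV x : pi (tg_inv G x) = tg_inv H (pi x).
  by apply: (@tgI _ H (pi x)); rewrite -piM !tg_mulgV.
apply/seteqP; split; last by move=> _ ->; apply: (W_intro (compact_normal_one H)).
move=> u /W_elim[N [cN nN] Nu]; have gN := normal_subgroup nN.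
(* As [pi] is open, images of finitely many translates of [C0] cover [N], so [P] lies in those
   translates multiplied by the compact [W]. *)
pose P := [set x | N (pi x)].
have nP : is_normal_subgroup G P.
  split; last by move=> g x; rewrite /P /= !piM piV; exact: (@normal_conj _ H).
  split; first by rewrite /P /= pi1; exact: subgroup1.
  split=> [x y|x]; rewrite /P /= ?piM ?piV; [exact: subgroupM|exact: subgroupV].
have [v Nv|s [_ hs]] := @compact_seq_cover _ T setT
    (fun x => pi @` [set y | C0 (tg_mul G (tg_inv G x) y)]) _ cN.
  have [x xv] := pis v; exists x => //.
  have [Z [oZ Zx] ZC] : exists2 Z, open_nbhs x Z & Z `<=` [set y | C0 (tg_mul G (tg_inv G x) y)].
    by have := nbhs_translate x nC0; rewrite nbhsE => -[Z]; exists Z.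
  have : nbhs v (pi @` Z) by apply: open_nbhs_nbhs; split; [exact: pio|exists x].
  by apply: filterS => _ [y /ZC Cy <-]; exists y.
have PX : P `<=` mulset G (mulset G [set x | x \in s] C0) (W G).
  move=> a Pa; have [x xs [y Cy ya]] := hs _ Pa.
  exists y, (tg_mul G (tg_inv G y) a); split; last by rewrite tgKV.
    by exists x, (tg_mul G (tg_inv G x) y); rewrite tgKV.
  by apply/pik; rewrite piM piV ya tg_mulVg.
have cX : compact (mulset G [set x | x \in s] C0).
  by apply: compact_mulset => //; apply: finite_compact; exact: finite_seq.
(* The closure is taken because [U] is not assumed Hausdorff, so closedness of the compact [N] is
   not at hand. *)
have hP : compact_normal G (closure P).
  split; last exact: normal_closure.
  apply: (@subclosed_compact _ _ (mulset G (mulset G [set x | x \in s] C0) (W G))).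
  - exact: closed_closure.
  - exact: compact_mulset.
  rewrite [X in _ `<=` X](closure_id _).1; last exact: closed_mulset.
  exact: closureS.
have [x xu] := pis u; rewrite -xu; apply/pik; apply: (W_intro hP).
by apply: subset_closure; rewrite /P /= xu.
Qed.

Theorem mainTheorem17 (T : topologicalType) (G : topGroup T) :
  locally_compact_group G -> compactly_generated G -> metabelian G ->
  (* (1) *)
  (compact (W G) /\ is_normal_subgroup G (W G) /\
   (forall (U : topologicalType) (H : topGroup U) (pi : T -> U),
      is_quotient_map G H (W G) pi -> W H = [set tg_one H]))
  /\
  (* (2) *)
  (W G = [set tg_one G] -> totally_disconnected [set: T] -> closed (derived G)).
Proof.
move=> [hT lcT] [K [cK genK]] metG.
have [C0 + [cC0 _]] := lcT (tg_one G) I; rewrite withinET => nC0.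
(* Adding inverses provides the symmetric generating set on which normality is tested in
   [normal_gen]. *)
pose S := K `|` tg_inv G @` K.
have cS : compact S.
  by apply: compactU => //; apply: compact_image => //; exact: tg_inv_cont.
have symS s : S s -> S (tg_inv G s).
  move=> [Ks|[k Kk <-]]; first by right; exists s.
  by left; rewrite tg_invK.
have genS : gen_subgroup G S = [set: T].
  apply/seteqP; split=> // x _.
  have : gen_subgroup G K x by rewrite genK.
  move=> /(_ _ (gen_subgroupP G S)); apply=> k Kk.
  by apply: sub_gen_subgroup; left.
have cW := compact_W hT cC0 nC0 cS genS symS metG.
split; last by move=> W1 td; exact: (closed_derived hT cC0 nC0 td cS genS symS metG W1).
split=> //; split=> [|U H pi]; first exact: normal_W.
by apply: (W_quotient cC0 nC0 cW); exact: (closed_W cC0 nC0 cS genS symS).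
Qed.
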